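(* Let $T=C$ (the Cesàro operator) or $T=C^*$ (the Copson operator). Let $I=[0,1]$ or $I=[0,\infty)$. If $X$ is a symmetric space on $I$ such that both $C$ and $C^*$ are bounded on $X$ and $X$ is not order continuous, then $TX$ cannot be renormed (with any equivalent norm) to have the fixed point property.
   Context: $m$ is Lebesgue measure, $L^0(I)$ the space of (a.e. classes of) real-valued Lebesgue measurable functions on $I$. A Banach function space $X$ on $I$ is a Banach space that is a linear subspace of $L^0(I)$ with the ideal property: $|f|\le|g|$ a.e., $f\in L^0(I)$, $g\in X$ imply $f\in X$ and $\|f\|_X\le\|g\|_X$; by convention $X$ also contains a function positive a.e. on $I$. A symmetric space is a Banach function space $X$ such that if $f,g\in L^0(I)$ are equimeasurable ($m\{|f|>s\}=m\{|g|>s\}$ for all $s>0$) and $f\in X$, then $g\in X$ and $\|f\|_X=\|g\|_X$. $X$ is order continuous if for every $f\in X$ and every decreasing sequence of measurable sets $A_n\subset I$ with empty intersection, $\|f\chi_{A_n}\|_X\to0$. Cesàro operator: $Cf(x)=\frac1x\int_0^x f(t)\,dt$ for $0<x\in I$. Copson operator: $C^*f(x)=\int_{I\cap[x,\infty)}\frac{f(t)}{t}\,dt$ for $x\in I$. $TX=\{f\in L^0(I): T|f|\in X\}$ with norm $\|f\|_{TX}=\|T|f|\|_X$. A Banach space $E$ has the fixed point property if for every nonempty closed bounded convex $K\subset E$, every nonexpansive map $S:K\to K$ ($\|S(x)-S(y)\|\le\|x-y\|$ for all $x,y\in K$) has a fixed point. *)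

(* Defs.v *)
From HB Require Import structures.
From mathcomp Require Import all_boot all_order all_algebra.
From mathcomp Require Import all_classical all_reals all_analysis.
From mathcomp Require Import measurable_realfun.

Set Implicit Arguments.
Unset Strict Implicit.
Unset Printing Implicit Defensive.

Import Order.TTheory GRing.Theory Num.Theory.
Import numFieldNormedType.Exports.

Local Open Scope classical_set_scope.
Local Open Scope ring_scope.

(* The library builds the quotient [{mfun_mu, T >-> R}] of measurable functions
   by a.e. equality, but not its vector space structure. *)
Section L0.
Context {d : measure_display} {T : measurableType d} {R : realType}.
Variable mu : {measure set T -> \bar R}.
Local Open Scope quotient_scope.

Definition L0 : Type := {mfun_ mu, T >-> R}.
HB.instance Definition _ := Choice.on L0.
HB.instance Definition _ := EqQuotient.on L0.

Definition L0_fun (f : L0) : T -> R := repr f.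
Definition L0_class (f : {mfun T >-> R}) : L0 := \pi_L0 f.

Lemma L0_classK (f : {mfun T >-> R}) :
  {ae mu, forall x, L0_fun (L0_class f) x = f x}.
Proof.
have : (repr (L0_class f) = f %[mod L0])%qT by rewrite reprK.
move=> /eqmodP /asboolP; apply: filterS => x; exact.
Qed.

Lemma L0_eqP (f g : L0) : {ae mu, forall x, L0_fun f x = L0_fun g x} -> f = g.
Proof.
move=> fg; rewrite -[f]reprK -[g]reprK; apply/eqmodP/asboolP.
by apply: filterS fg => x + _.
Qed.

Let rp (f : L0) : {mfun T >-> R} := repr f.

Definition L0_zero : L0 := L0_class 0.
Definition L0_opp (f : L0) : L0 := L0_class (- rp f).
Definition L0_add (f g : L0) : L0 := L0_class (rp f + rp g).
Definition L0_scale (a : R) (f : L0) : L0 := L0_class (a *: rp f).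

Lemma L0_zeroE : {ae mu, forall x, L0_fun L0_zero x = 0}.
Proof. exact: L0_classK. Qed.
Lemma L0_oppE f : {ae mu, forall x, L0_fun (L0_opp f) x = - L0_fun f x}.
Proof. exact: L0_classK. Qed.
Lemma L0_addE f g :
  {ae mu, forall x, L0_fun (L0_add f g) x = L0_fun f x + L0_fun g x}.
Proof. exact: L0_classK. Qed.
Lemma L0_scaleE a f :
  {ae mu, forall x, L0_fun (L0_scale a f) x = a * L0_fun f x}.
Proof. exact: L0_classK. Qed.

Lemma L0_addA : associative L0_add.
Proof.
move=> f g h; apply: L0_eqP.
have := L0_addE f (L0_add g h); have := L0_addE g h.
have := L0_addE (L0_add f g) h; have := L0_addE f g.
move=> h1 h2 h3 h4; apply: filterS2 (filterI h1 h2) (filterI h3 h4).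
by move=> x [e1 e2] [e3 e4]; rewrite e4 e3 e2 e1 addrA.
Qed.

Lemma L0_addC : commutative L0_add.
Proof.
move=> f g; apply: L0_eqP.
have := L0_addE f g; have := L0_addE g f.
by apply: filterS2 => x -> ->; rewrite addrC.
Qed.

Lemma L0_add0 : left_id L0_zero L0_add.
Proof.
move=> f; apply: L0_eqP.
have := L0_addE L0_zero f; have := L0_zeroE.
by apply: filterS2 => x e ->; rewrite e add0r.
Qed.

Lemma L0_addN : left_inverse L0_zero L0_opp L0_add.
Proof.
move=> f; apply: L0_eqP.
have := L0_addE (L0_opp f) f; have := L0_oppE f; have := L0_zeroE.
by apply: filterS3 => x -> e ->; rewrite e addNr.
Qed.

HB.instance Definition _ :=
  GRing.isZmodule.Build L0 L0_addA L0_addC L0_add0 L0_addN.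

Lemma L0_scaleA a b f : L0_scale a (L0_scale b f) = L0_scale (a * b) f.
Proof.
apply: L0_eqP.
have := L0_scaleE a (L0_scale b f); have := L0_scaleE b f.
have := L0_scaleE (a * b) f.
by apply: filterS3 => x -> e ->; rewrite e mulrA.
Qed.

Lemma L0_scale1 : left_id 1 L0_scale.
Proof.
move=> f; apply: L0_eqP.
by have := L0_scaleE 1 f; apply: filterS => x ->; rewrite mul1r.
Qed.

Lemma L0_scaleDr : right_distributive L0_scale +%R.
Proof.
move=> a f g; apply: L0_eqP.
have := L0_scaleE a (f + g); have := L0_addE f g.
have := L0_addE (L0_scale a f) (L0_scale a g).
have := L0_scaleE a f; have := L0_scaleE a g.
move=> h1 h2 h3 h4 h5.
apply: filterS3 h5 (filterI h1 h2) (filterI h3 h4).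
by move=> x e5 [e1 e2] [e3 e4]; rewrite e5 e3 e2 e1 e4 mulrDr.
Qed.

Lemma L0_scaleDl f : {morph L0_scale^~ f : a b / a + b}.
Proof.
move=> a b; apply: L0_eqP.
have := L0_addE (L0_scale a f) (L0_scale b f).
have := L0_scaleE (a + b) f; have := L0_scaleE a f; have := L0_scaleE b f.
move=> h1 h2 h3 h4; apply: filterS2 (filterI h1 h2) (filterI h3 h4).
by move=> x [e1 e2] [e3 e4]; rewrite e4 e3 e2 e1 mulrDl.
Qed.

HB.instance Definition _ := GRing.Zmodule_isLmodule.Build R L0
  L0_scaleA L0_scale1 L0_scaleDr L0_scaleDl.

End L0.

Section LebesgueOnInterval.
Context {R : realType}.

(* [R] with the sigma-algebra of Lebesgue measurable sets; [R] itself carries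
   the Borel sigma-algebra. *)
Definition lebR : measurableType _ :=
  caratheodory_type (mu_ext (@wlength R idfun)).

Definition leb : {measure set lebR -> \bar R} := @completed_lebesgue_measure R.

Lemma measurable_lebR_itv (I : interval R) : measurable ([set` I] : set lebR).
Proof. by apply: sub_caratheodory; exact: measurable_itv. Qed.

(* Measures only the part of a set inside [I], so that "a.e. on I" is
   "almost everywhere for [leb_on I]". *)
Definition leb_on (I : interval R) : {measure set lebR -> \bar R} :=
  mrestr leb (measurable_lebR_itv I).

End LebesgueOnInterval.

Notation L0_on I := (L0 (leb_on I)).

Section Operators.
Context {R : realType}.
Local Open Scope ereal_scope.

(* The operators take extended real values. The library integral of a real
   function that is not integrable is infinite (with [+oo - +oo = -oo]), so a
   finite value entails integrability.  The value at [x = 0] plays no role: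
   these functions are only used up to null sets. *)
Definition cesaro_op (f : @lebR R -> R) : @lebR R -> \bar R :=
  fun x : R => (x^-1)%:E * \int[leb]_(t in `[0%R, x]) (f t)%:E.

Definition copson_op (I : interval R) (f : @lebR R -> R) : @lebR R -> \bar R :=
  fun x : R =>
    \int[leb]_(t in [set` I] `&` `[x, +oo[) (f t / (t : R))%:E.

End Operators.

Section FunctionSpaces.
Context {R : realType} (I : interval R).

(* A Banach space that is a linear subspace of [L0_on I] is given as a complete
   normed space together with its inclusion map. *)
Record banachFunctionSpace := BanachFunctionSpace {
  bfs_space :> completeNormedModType R;
  bfs_incl : {linear bfs_space -> L0_on I};
  bfs_incl_inj : injective bfs_incl;
  bfs_ideal : forall (f : L0_on I) (g : bfs_space),
    {ae leb_on I, forall x, `|L0_fun f x| <= `|L0_fun (bfs_incl g) x|} ->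
    exists2 h : bfs_space, bfs_incl h = f & `|h| <= `|g|;
  bfs_pos : exists g : bfs_space,
    {ae leb_on I, forall x, 0 < L0_fun (bfs_incl g) x}
}.

Definition equimeasurable (f g : L0_on I) : Prop :=
  forall s : R, 0 < s ->
    leb_on I [set x | s < `|L0_fun f x|] = leb_on I [set x | s < `|L0_fun g x|].

Definition symmetric_space (X : banachFunctionSpace) : Prop :=
  forall (f : L0_on I) (g : X), equimeasurable f (bfs_incl X g) ->
    exists2 h : X, bfs_incl X h = f & `|h| = `|g|.

Definition order_continuous (X : banachFunctionSpace) : Prop :=
  forall (f : X) (A : nat -> set (@lebR R)),
    (forall n, measurable (A n)) -> (forall n, A n `<=` [set` I]) ->
    (forall n, A n.+1 `<=` A n) -> \bigcap_n A n = set0 ->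
    forall h : nat -> X,
      (forall n, {ae leb_on I, forall x,
        L0_fun (bfs_incl X (h n)) x = L0_fun (bfs_incl X f) x * \1_(A n) x}) ->
      (fun n => `|h n|) @ \oo --> (0 : R).

(* [g] is the class of the extended real function [u]. *)
Definition is_class_of (u : @lebR R -> \bar R) (g : L0_on I) : Prop :=
  {ae leb_on I, forall x, (L0_fun g x)%:E = u x}.

Definition bounded_on (T : (@lebR R -> R) -> @lebR R -> \bar R)
    (X : banachFunctionSpace) : Prop :=
  exists M : R, forall f : X, exists2 g : X,
    is_class_of (T (L0_fun (bfs_incl X f))) (bfs_incl X g) & `|g| <= M * `|f|.

Section OptimalDomain.
Variables (T : (@lebR R -> R) -> @lebR R -> \bar R) (X : banachFunctionSpace).

(* The elements of [X] representing [T|f|]: at most one. *)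
Definition T_abs (f : L0_on I) : set X :=
  [set g : X | is_class_of (T (fun x => `|L0_fun f x|)) (bfs_incl X g)].

Definition TX : set (L0_on I) := [set f | T_abs f !=set0].

Definition TX_norm (f : L0_on I) : R := `|xget 0 (T_abs f)|.

(* The linear space [TX] with a norm equivalent to [TX_norm]. As above, a
   subspace of [L0_on I] is given by its inclusion map. *)
Record TX_renorming := TXRenorming {
  rn_space :> normedModType R;
  rn_incl : {linear rn_space -> L0_on I};
  rn_incl_inj : injective rn_incl;
  rn_range : range rn_incl = TX;
  rn_equiv : exists a b : R, [/\ 0 < a, 0 < b & forall f : rn_space,
    a * TX_norm (rn_incl f) <= `|f| <= b * TX_norm (rn_incl f)]
}.

End OptimalDomain.
End FunctionSpaces.

Definition fixed_point_property {R : realType} (E : normedModType R) : Prop :=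
  forall K : set E, K !=set0 -> closed K -> bounded_set K -> convex_set K ->
  forall S : E -> E, (forall x, K x -> K (S x)) ->
    (forall x y, K x -> K y -> `|S x - S y| <= `|x - y|) ->
    exists2 x, K x & S x = x.

(* Main.v *)
Require Import Defs.
From mathcomp Require Import all_boot all_order all_algebra.
From mathcomp Require Import all_classical all_reals all_analysis.
From mathcomp Require Import measurable_realfun ring lra zify.

Set Implicit Arguments.
Unset Strict Implicit.
Unset Printing Implicit Defensive.

Import Order.TTheory GRing.Theory Num.Theory.
Import numFieldNormedType.Exports.

Local Open Scope classical_set_scope.
Local Open Scope ring_scope.

(** The proof shows that every renorming of [TX] contains an isomorphic copy of
    [l^infty], and that no norm equivalent to the supremum norm of [l^infty] has
    the fixed point property.

    - Renormings of [l^infty] ([linfty_copy_not_fpp]).  For an infinite set [M]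
      of indices let [s(M)] be the supremum of the new norm over the sequences
      supported in [M] and bounded by [1].  Repeatedly halving infinite sets on
      which [s] is almost minimal gives disjoint blocks, and sequences [x_k] on
      them bounded by [1], whose norms tend to some [s > 0], while everything
      bounded by [1] and supported on the blocks from [j] on has norm at most
      [s + e j] ([asymptotic_blocks]).  Rademacher-like sums [z_j = sum_k +-x_k] of
      these vectors then span an asymptotically isometric copy of [l^1]:
      [sum |a j| (s - e j) <= |sum a j z_j| <= sum |a j| (s + e j)].  The lower
      bound is James' reflection argument ([J_comb_ge_head]).  With slowly
      decreasing weights [lam j], the right shift of coefficients is
      nonexpansive on the closed convex set of all [sum a j lam j z_j] with [a]
      a probability sequence, and it has no fixed point there.

    - From disjoint sequences to [l^infty] ([optimal_domain_linfty_copy]).  If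
      [F >= 0] is in [X] and [B k] are disjoint sets such that the norms of
      [T (F chi_(B k))] stay away from [0], then [t |-> sum_k t k F chi_(B k)]
      embeds [l^infty] into [TX].  Such sets exist as soon as the norms of
      [T (F chi_(A n))] do not tend to [0] for some [A n] decreasing to the
      empty set ([disjoint_not_small]).

    - Failure of order continuity passes from [X] to [TX].  Given [f] in [X],
      its decreasing rearrangement [f*] is dominated by a function [F] of [X]
      which is positive, nonincreasing and satisfies [F x <= 2 F (2 x)]
      ([exists_doubling_majorant]); this uses that [C f*] is in [X].  Let [A n]
      be the part of [I] outside of [[1/n, n]].  Since [F] varies slowly,
      [T (F chi_(A n))] is at least [F / 4] on [A (2 n)] for both operators
      ([cesaro_ends_ge], [copson_ends_ge]).  So if these functions tended to [0]
      in norm, then so would [F chi_(A n)], and the rearrangements of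
      [f chi_(B k)], for [B k] decreasing to the empty set, would be small on
      [A n] because they are at most [F], and outside of [A n] because they tend
      to [0] uniformly there ([order_continuous_of_ends]).  Boundedness of [C*]
      excludes nonzero constants from [X] when [I] is the half-line, so that all
      distribution functions are finite. *)

(** * Renormings of the space of bounded sequences: asymptotic blocks *)

Lemma infinite_nat_split (A : set nat) : infinite_set A ->
  exists N Q : set nat, [/\ N `<=` A, Q `<=` A, N `&` Q = set0,
    infinite_set N & infinite_set Q].
Proof.
move=> /infiniteP/ppcard_leP[f].
have finj m n : f m = f n -> m = n by apply: (@inj _ _ _ f); rewrite inE.
have fA n : A (f n) by apply: (@funS _ _ _ _ f).
have inf (g : nat -> nat) : injective g -> infinite_set (range (f \o g)).
  move=> ginj; rewrite (eq_finite_set (inj_card_eq _)); first exact: infinite_nat.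
  by move=> m n _ _ /= /finj/ginj.
exists (range (f \o double)), (range (f \o (succn \o double))); split.
- by move=> _ [n _ <-]; exact: fA.
- by move=> _ [n _ <-]; exact: fA.
- rewrite -subset0 => _ [[m _ <-] [n _ /=]] /finj e.
  by move: (congr1 odd e); rewrite /= !odd_double.
- by apply: inf => m n /double_inj.
- by apply: inf => m n /= [] /double_inj.
Qed.

Section LinftyCopy.
Variables (R : realType) (E : normedModType R) (J : (nat -> R) -> E).

Definition bounded_by (t : nat -> R) (c : R) := forall i, `|t i| <= c.

(** An isomorphic embedding of [l^infty], coded as a map on all sequences that
    is only controlled on the bounded ones. *)
Definition linfty_copy (al be : R) : Prop :=
  [/\ 0 < al,
   forall a t s c, bounded_by t c -> bounded_by s c ->
     J (fun i => a * t i + s i) = a *: J t + J s,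
   forall t c, bounded_by t c -> `|J t| <= be * c &
   forall t c i, bounded_by t c -> al * `|t i| <= `|J t| ].

Variables (al be : R) (HJ : linfty_copy al be).

Let al0 : 0 < al. Proof. by case: HJ. Qed.

Definition unit_vectors_on (M : set nat) : set (nat -> R) :=
  [set t | bounded_by t 1 /\ forall i, ~ M i -> t i = 0].

Definition sup_on (M : set nat) : R := sup [set `|J t| | t in unit_vectors_on M].

(** [sup_on] is monotone; this is the value below which it cannot be brought by
    passing to infinite subsets of [Q]. *)
Definition hereditary_inf (Q : set nat) : R :=
  inf [set sup_on M | M in [set M | M `<=` Q /\ infinite_set M]].

Lemma has_sup_on M : has_sup [set `|J t| | t in unit_vectors_on M].
Proof.
split; first by exists `|J (fun=> 0)|, (fun=> 0) => //; split => // i; rewrite normr0.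
by exists be => _ [t [t1 _] <-]; case: HJ => _ _ /(_ _ _ t1); rewrite mulr1.
Qed.

Lemma le_sup_on M t : unit_vectors_on M t -> `|J t| <= sup_on M.
Proof. by move=> tM; apply: ub_le_sup; [case: (has_sup_on M)|exists t]. Qed.

Lemma sup_on_ge M : infinite_set M -> al <= sup_on M.
Proof.
move=> /infinite_setN0[i Mi]; case: HJ => _ _ _ Jge.
have u : unit_vectors_on M (fun j => (j == i)%:R).
  split=> j /=; first by case: (j == i); rewrite ?normr1 ?normr0.
  by case: eqP => [-> /(_ Mi)|].
apply: le_trans (le_sup_on u); have [u1 _] := u.
by have := Jge _ _ i u1; rewrite eqxx normr1 mulr1.
Qed.

Lemma has_hereditary_inf Q : infinite_set Q ->
  has_inf [set sup_on M | M in [set M | M `<=` Q /\ infinite_set M]].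
Proof.
move=> Qi; split; first by exists (sup_on Q); exists Q => //; split.
by exists al => _ [M [_ Mi] <-]; exact: sup_on_ge.
Qed.

Lemma hereditary_inf_le Q M : M `<=` Q -> infinite_set M ->
  hereditary_inf Q <= sup_on M.
Proof.
move=> MQ Mi; apply: ge_inf; last by exists M.
by case: (has_hereditary_inf (sub_infinite_set MQ Mi)).
Qed.

Lemma hereditary_inf_sub Q Q' : infinite_set Q' -> Q' `<=` Q ->
  hereditary_inf Q <= hereditary_inf Q'.
Proof.
move=> Qi QQ; apply: lb_le_inf; first by case: (has_hereditary_inf Qi).
by move=> _ [M [MQ Mi] <-]; apply: hereditary_inf_le => // ?/MQ/QQ.
Qed.

(** Halve an infinite [M] included in [Q] with [sup_on M] almost minimal: what is
    left of [M] satisfies the upper bound, and each half, being an infinite subset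
    of [Q], still reaches the infimum. *)
Lemma near_minimal_split Q e : infinite_set Q -> 0 < e ->
  exists (N Q' : set nat) (x : nat -> R),
  [/\ N `<=` Q, Q' `<=` Q & N `&` Q' = set0] /\
  [/\ infinite_set Q',
    forall t, unit_vectors_on (N `|` Q') t -> `|J t| <= hereditary_inf Q + e,
    unit_vectors_on N x & hereditary_inf Q - e <= `|J x| ].
Proof.
move=> Qi e0.
have [_ [M [MQ Mi] <-] Me] := inf_adherent e0 (has_hereditary_inf Qi).
have [N [Q' [NM QM NQ Ni Q'i]]] := infinite_nat_split Mi.
have [_ [x xN <-] xe] := sup_adherent e0 (has_sup_on N).
exists N, Q', x; split; split => //.
- by move=> i /NM/MQ.
- by move=> i /QM/MQ.
- move=> t [t1 tNQ]; apply: le_trans (ltW Me); apply: le_sup_on; split => // i nM.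
  by apply: tNQ => -[/NM|/QM].
- apply: le_trans (ltW xe); rewrite lerB// hereditary_inf_le// => i /NM/MQ//.
Qed.

(** Iterating [near_minimal_split] gives disjoint sets [N k]; the infima of the
    successive remainders increase to [s], so the upper bounds and the norms of
    the block vectors are governed by the same number.  The block vectors are
    coded by a single function [X], the [k]-th one being its restriction to
    [kappa = k]; outside of all blocks [X] vanishes. *)
Lemma asymptotic_blocks (e : nat -> R) : (forall j, 0 < e j) ->
  (forall d, 0 < d -> exists K, forall k, (K <= k)%N -> e k <= d) ->
  exists (s : R) (X : nat -> R) (kappa : nat -> nat),
  [/\ al <= s, bounded_by X 1,
    forall j t, (forall i, `|t i| <= (j <= kappa i)%:R * `|X i|) ->
      `|J t| <= s + e j &
    forall d, 0 < d -> exists K, forall k, (K <= k)%N ->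
      s - d <= `|J (fun i => (kappa i == k)%:R * X i)| ].
Proof.
move=> e0 elim0.
pose IQ := {Q : set nat | infinite_set Q}.
have /choice[g gP] : forall p : IQ * nat, exists q : set nat * IQ * (nat -> R),
  [/\ q.1.1 `<=` sval p.1, sval q.1.2 `<=` sval p.1 &
     q.1.1 `&` sval q.1.2 = set0] /\
  [/\ infinite_set (sval q.1.2),
    forall t, unit_vectors_on (q.1.1 `|` sval q.1.2) t ->
      `|J t| <= hereditary_inf (sval p.1) + e p.2,
    unit_vectors_on q.1.1 q.2 &
    hereditary_inf (sval p.1) - e p.2 <= `|J q.2| ].
  move=> [[Q Qi] n] /=.
  have [N [Q' [x [h [Q'i h1 h2 h3]]]]] := near_minimal_split Qi (e0 n).
  by exists (N, exist _ Q' Q'i, x).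
pose st := fix st n : IQ := if n is m.+1 then (g (st m, m)).1.2
  else exist _ [set: nat] infinite_nat.
pose Q n : set nat := sval (st n).
pose N n : set nat := (g (st n, n)).1.1.
pose x n : nat -> R := (g (st n, n)).2.
have Qi n : infinite_set (Q n) by rewrite /Q; case: (st n).
have H n := gP (st n, n).
have QS n : Q n.+1 `<=` Q n by case: (H n) => -[].
have Qle m n : (m <= n)%N -> Q n `<=` Q m.
  elim: n => [|n IH]; first by rewrite leqn0 => /eqP ->.
  by rewrite leq_eqVlt => /orP[/eqP->//|] /IH h i /QS/h.
have NQ n : N n `<=` Q n by case: (H n) => -[].
have NQ0 n : N n `&` Q n.+1 = set0 by case: (H n) => -[].
have Nlt m n i : (m < n)%N -> N m i -> N n i -> False.
  move=> mn Nm Nn; have : (N m `&` Q m.+1) i by split => //; exact: Qle mn _ (NQ _ _ Nn).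
  by rewrite NQ0.
have Ndisj m n i : N m i -> N n i -> m = n.
  by move=> Nm Nn; case: (ltngtP m n) => // mn;
    [case: (Nlt _ _ _ mn Nm Nn)|case: (Nlt _ _ _ mn Nn Nm)].
have xN n : unit_vectors_on (N n) (x n) by case: (H n) => _ [].
pose h n := hereditary_inf (Q n).
have hle n m : (n <= m)%N -> h n <= h m.
  by move=> nm; apply: hereditary_inf_sub; [exact: Qi|exact: Qle].
have hbe n : h n <= be.
  apply: (@le_trans _ _ (sup_on (Q n))); first by apply: hereditary_inf_le.
  apply: ge_sup; first by case: (has_sup_on (Q n)).
  by move=> _ [t [t1 _] <-]; case: HJ => _ _ /(_ _ _ t1); rewrite mulr1.
have hs : has_sup (range h).
  by split; [exists (h 0%N), 0%N|exists be => _ [n _ <-]].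
pose s := sup (range h).
have hles n : h n <= s by apply: ub_le_sup; [case: hs|exists n].
pose kappa i := xget 0%N [set k | N k i].
pose X i := x (kappa i) i.
have kN k i : N k i -> kappa i = k.
  by move=> Nk; rewrite /kappa; case: xgetP => [y _ /= Ny|/(_ k)//]; exact: Ndisj Ny Nk.
have X0 i : (forall k, ~ N k i) -> X i = 0.
  by move=> nN; rewrite /X; case: (xN (kappa i)) => _; apply; exact: nN.
exists s, X, kappa; split.
- apply: le_trans (hles 0%N); apply: lb_le_inf; first by case: (has_hereditary_inf (Qi 0%N)).
  by move=> _ [M [_ Mi] <-]; exact: sup_on_ge.
- by move=> i; have [/(_ i)] := xN (kappa i).
- move=> j t tX; case: (H j) => _ [_ hj _ _].
  apply: (le_trans (hj t _)); last by rewrite /= lerD2r; exact: hles.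
  split=> [i|i nN].
    apply: le_trans (tX i) _; case: (xN (kappa i)) => /(_ i) x1 _.
    by case: leqP => _; rewrite ?mul1r// mul0r.
  have := tX i; case: leqP => jk; last by rewrite mul0r normr_le0 => /eqP.
  rewrite X0 ?normr0 ?mulr0 ?normr_le0; first by move/eqP.
  move=> k Nk; apply: nN; have := kN _ _ Nk; move: jk => /[swap] -> .
  rewrite leq_eqVlt => /orP[/eqP jk|jk]; first by left; rewrite jk.
  by right; apply: (Qle j.+1 k) => //; exact: NQ.
- move=> d d0; have d20 : 0 < d / 2 by lra.
  have [_ [n _ <-] hn] := sup_adherent d20 hs.
  have [K HK] := elim0 _ d20.
  exists (maxn n K) => k; rewrite geq_max => /andP[nk Kk].
  have -> : (fun i => (kappa i == k)%:R * X i) = x k.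
    apply/funext => i; case: (pselect (N k i)) => [Nk|nN].
      by rewrite /X (kN _ _ Nk) eqxx mul1r.
    have -> : x k i = 0 by case: (xN k) => _; apply.
    case: eqP => kk; rewrite ?mul0r// /X kk; case: (xN k) => _ /(_ i nN) ->.
    by rewrite mulr0.
  case: (H k) => _ [_ _ _ /=]; rewrite -/(x k) -/(Q k) -/(h k).
  have := hle _ _ nk; have := HK _ Kk; rewrite -/s in hn *; lra.
Qed.

End LinftyCopy.

(** * Asymptotically isometric copies of [l^1] *)

Definition bit_sign (R : realType) (j k : nat) : R := (-1) ^+ odd (k %/ 2 ^ j).

(** Every finite pattern of signs recurs arbitrarily far, as for the Rademacher
    functions. *)
Lemma bit_pattern (p : nat -> bool) (n K : nat) :
  exists2 k, (K <= k)%N & forall j, (j < n)%N -> odd (k %/ 2 ^ j) = p j.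
Proof.
elim: n p => [|n IH] p; first by exists K.
have [k Kk kp] := IH (p \o succn).
exists (p 0%N + k.*2)%N; first by rewrite -addnn addnA (leq_trans Kk)// leq_addl.
case=> [_|j jn]; first by rewrite divn1 oddD odd_double addbF; case: (p 0%N).
rewrite expnS divnMA -muln2 addnC divnMDl// -[RHS](kp j jn) /=; congr (odd (_ %/ _)).
by rewrite divn_small ?addn0//; case: (p 0%N).
Qed.

Lemma sum_ord_swap (R : pzSemiRingType) (m n : nat) (G : nat -> R) :
  \sum_(j < m) (j < n)%:R * G j = \sum_(j < n) (j < m)%:R * G j.
Proof.
wlog mn : m n / (m <= n)%N.
  by move=> H; case/orP: (leq_total m n) => /H ->.
rewrite (big_ord_widen _ (fun j => (j < n)%:R * G j) mn) big_mkcond.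
by apply: eq_bigr => j _; rewrite ltn_ord mul1r; case: ltnP; rewrite ?mul1r ?mul0r.
Qed.

Section AbsSummable.
Variable R : realType.
Implicit Types (a b : nat -> R) (C : R).

Definition partial_sums_le a C := forall n, \sum_(j < n) `|a j| <= C.

Definition tail n a : nat -> R := fun j => if (n <= j)%N then a j else 0.
Definition head n a : nat -> R := fun j => if (j < n)%N then a j else 0.

(** The Cauchy form of absolute summability, ready for splitting off a tail. *)
Definition abs_summable a :=
  forall e, 0 < e -> exists n, partial_sums_le (tail n a) e.

Lemma abs_summable_bounded a : abs_summable a -> exists C, partial_sums_le a C.
Proof.
move=> /(_ 1 ltr01)[n na]; exists (\sum_(j < n) `|a j| + 1) => m.
have -> : \sum_(j < m) `|a j| =
    \sum_(j < m) `|head n a j| + \sum_(j < m) `|tail n a j|.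
  rewrite -big_split; apply: eq_bigr => j _ /=; rewrite /head /tail.
  by case: leqP => _; rewrite normr0 ?addr0 ?add0r.
apply: lerD (na m).
have [mn|nm] := leqP m n.
  rewrite (big_ord_widen _ (fun j => `|head n a j|) mn) big_mkcond.
  by apply: ler_sum => j _; rewrite /head ltn_ord; case: ifP => _.
rewrite (big_ord_widen _ (fun j => `|a j|) (ltnW nm)) [leRHS]big_mkcond.
by apply: ler_sum => j _; rewrite /head; case: ltnP; rewrite ?normr0.
Qed.

Lemma abs_summable_le a b C : 0 <= C -> abs_summable b ->
  (forall j, `|a j| <= C * `|b j|) -> abs_summable a.
Proof.
move=> C0 bs ab e e0.
have C1 : 0 < C + 1 by lra.
have [n nb] := bs (e / (C + 1)) (divr_gt0 e0 C1); exists n => m.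
have -> : e = (C + 1) * (e / (C + 1)) by field; lra.
apply: le_trans (_ : (C + 1) * \sum_(j < m) `|tail n b j| <= _); last first.
  by rewrite ler_pM2l.
rewrite mulr_sumr; apply: ler_sum => j _; rewrite /tail; case: ifP => _.
  by apply: le_trans (ab j) _; rewrite ler_wpM2r// lerDl.
by rewrite normr0 mulr0.
Qed.

Lemma abs_summableD a b : abs_summable a -> abs_summable b ->
  abs_summable (fun j => `|a j| + `|b j|).
Proof.
move=> sa sb e e0; have e2 : 0 < e / 2 by lra.
have [n na] := sa _ e2; have [m mb] := sb _ e2.
exists (maxn n m) => k; have -> : e = e / 2 + e / 2 by field.
apply: le_trans (lerD (na k) (mb k)); rewrite -big_split; apply: ler_sum => j _.
rewrite /tail geq_max; case: leqP => nj; case: leqP => mj //=;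
  rewrite ?normr0 ?addr0 ?addr_ge0//.
by rewrite ger0_norm// addr_ge0.
Qed.

Lemma abs_summableB a b : abs_summable a -> abs_summable b ->
  abs_summable (fun j => a j - b j).
Proof.
move=> sa sb; apply: (abs_summable_le ler01 (abs_summableD sa sb)) => j.
by rewrite mul1r [leRHS]ger0_norm ?addr_ge0// (le_trans (ler_normB _ _)).
Qed.

End AbsSummable.

(** Rademacher-like combinations of asymptotic blocks: [comb a] stands for
    [sum_j a j *: z_j] where [z_j] equals [bit_sign j k * X] on the block
    [kappa = k] when [j <= k]; each point meets finitely many [z_j]. *)
Section RademacherL1.
Variables (R : realType) (E : normedModType R) (J : (nat -> R) -> E).
Variables (al be : R) (HJ : linfty_copy J al be).
Variables (e : nat -> R) (s : R) (X : nat -> R) (kappa : nat -> nat).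
Hypothesis X1 : bounded_by X 1.
Hypothesis block_le : forall j t,
  (forall i, `|t i| <= (j <= kappa i)%:R * `|X i|) -> `|J t| <= s + e j.
Hypothesis block_ge : forall d, 0 < d -> exists K, forall k, (K <= k)%N ->
  s - d <= `|J (fun i => (kappa i == k)%:R * X i)|.
Hypothesis e_le : forall j, e j <= s.
Implicit Types (a b : nat -> R) (C : R).

Definition comb a : nat -> R :=
  fun i => X i * \sum_(j < (kappa i).+1) a j * bit_sign R j (kappa i).

Lemma norm_bit_sign j k : `|bit_sign R j k| = 1.
Proof. by rewrite /bit_sign normrX normrN1 expr1n. Qed.

Lemma comb_bounded a C : partial_sums_le a C -> bounded_by (comb a) C.
Proof.
move=> aC i; rewrite /comb normrM; apply: le_trans (ler_piMl _ (X1 i)) _ => //.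
apply: le_trans (aC (kappa i).+1); apply: le_trans (ler_norm_sum _ _ _) _.
by apply: ler_sum => j _; rewrite normrM norm_bit_sign mulr1.
Qed.

Lemma J0 : J (fun=> 0) = 0.
Proof.
have b0 : bounded_by (fun=> 0 : R) 0 by move=> i; rewrite normr0.
by apply/eqP; rewrite -normr_le0; case: HJ => _ _ /(_ _ _ b0); rewrite mulr0.
Qed.

Lemma J_scale c t C : bounded_by t C -> J (fun i => c * t i) = c *: J t.
Proof.
move=> tC; have C0 : 0 <= C by apply: le_trans (tC 0%N).
case: HJ => _ /(_ c t (fun=> 0) C tC) lin _ _.
rewrite -[RHS]addr0 -J0 -lin; last by move=> i; rewrite normr0.
by congr J; apply/funext => i; rewrite addr0.
Qed.

Lemma J_comb_linear c a b : abs_summable a -> abs_summable b ->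
  J (comb (fun j => c * a j + b j)) = c *: J (comb a) + J (comb b).
Proof.
move=> /abs_summable_bounded[A aA] /abs_summable_bounded[B bB].
case: HJ => _ lin _ _; rewrite -(lin c _ _ (A + B)).
- congr J; apply/funext => i; rewrite /comb mulrCA -mulrDr; congr (_ * _).
  by rewrite mulr_sumr -big_split; apply: eq_bigr => j _ /=; rewrite mulrDl mulrA.
- apply: comb_bounded => n; apply: le_trans (aA n) _; rewrite lerDl.
  by apply: le_trans (bB 0%N); rewrite big_ord0.
- apply: comb_bounded => n; apply: le_trans (bB n) _; rewrite lerDr.
  by apply: le_trans (aA 0%N); rewrite big_ord0.
Qed.

Lemma abs_summable_head n a : abs_summable (head n a).
Proof.
move=> d d0; exists n => m; rewrite big1 ?ltW// => j _.
by rewrite /tail /head; case: leqP => _; rewrite normr0.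
Qed.

Lemma J_comb_le0 a C : partial_sums_le a C -> `|J (comb a)| <= be * C.
Proof. by move=> /comb_bounded h; case: HJ => _ _ /(_ _ _ h). Qed.

Lemma abs_summable_tail n a : abs_summable a -> abs_summable (tail n a).
Proof.
move=> /(abs_summable_le ler01); apply=> j; rewrite mul1r /tail.
by case: ifP; rewrite ?normr0.
Qed.

Lemma J_comb_head_tail n a : abs_summable a ->
  J (comb a) = J (comb (head n a)) + J (comb (tail n a)).
Proof.
move=> sa; rewrite -[J (comb (head n a))]scale1r -J_comb_linear.
- congr (J (comb _)); apply/funext => j; rewrite /head /tail mul1r.
  by case: leqP; rewrite ?addr0 ?add0r.
- exact: abs_summable_head.
- exact: abs_summable_tail.
Qed.

Lemma norm_J_sum n (c : nat -> R) (w : nat -> nat -> R) (d : nat -> R) :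
  (forall j, (j < n)%N -> bounded_by (w j) 2) -> (forall j, (j < n)%N -> `|J (w j)| <= d j) ->
  `|J (fun i => \sum_(j < n) c j * w j i)| <= \sum_(j < n) `|c j| * d j.
Proof.
elim: n => [|n IH] w2 wd.
  rewrite big_ord0 (_ : (fun _ => _) = fun=> 0) ?J0 ?normr0//.
  by apply/funext => i; rewrite big_ord0.
rewrite big_ord_recr/=.
pose B := 2 + \sum_(j < n) `|c j| * 2.
have B0 : 0 <= \sum_(j < n) `|c j| * 2 by apply: sumr_ge0 => j _; rewrite mulr_ge0.
have -> : J (fun i => \sum_(j < n.+1) c j * w j i) =
    c n *: J (w n) + J (fun i => \sum_(j < n) c j * w j i).
  case: HJ => _ lin _ _; rewrite -(lin _ _ _ B).
  - by congr J; apply/funext => i; rewrite big_ord_recr/= addrC.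
  - by move=> i; apply: le_trans (w2 n (ltnSn n) i) _; rewrite lerDl.
  - move=> i; apply: le_trans (ler_norm_sum _ _ _) _; rewrite /B.
    rewrite -[leLHS]add0r lerD//; apply: ler_sum => j _; rewrite normrM.
    by rewrite ler_wpM2l// w2// ltnS ltnW.
rewrite addrC (le_trans (ler_normD _ _))// lerD//.
  by rewrite normrZ ler_wpM2l// wd.
by apply: IH => j jn; [apply: w2|apply: wd]; rewrite ltnS ltnW.
Qed.

(** James' reflection: on a block [k] where all the signs agree with those of
    [a], [2 x_k - sgn (a j) z_j] is still bounded by [|X|], so that
    [2 (sum |a j|) |x_k| <= |J (comb a)| + sum |a j| (s + e j)]. *)
Lemma J_comb_ge_head n a : \sum_(j < n) `|a j| * (s - e j) <= `|J (comb (head n a))|.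
Proof.
set A := \sum_(j < n) `|a j|.
have A0 : 0 <= A by apply: sumr_ge0.
apply/ler_addgt0Pr => d d0.
have A1 : 0 < 2 * A + 1 by lra.
have [K HK] := block_ge (divr_gt0 d0 A1).
have [k Kk kp] := bit_pattern (fun j => a j < 0) n (maxn K n).
have {}HK := HK k (leq_trans (leq_maxl _ _) Kk).
have nk := leq_trans (leq_maxr _ _) Kk.
have abit j : (j < n)%N -> a j = `|a j| * bit_sign R j k.
  move=> jn; rewrite /bit_sign kp//; case: ltP => aj; first by rewrite ltr0_norm//; ring.
  by rewrite ger0_norm// mulr1.
pose xk i := (kappa i == k)%:R * X i.
pose w j i := 2 * xk i - bit_sign R j k * ((j <= kappa i)%:R * bit_sign R j (kappa i) * X i).
have wX j i : (j < n)%N -> `|w j i| <= (j <= kappa i)%:R * `|X i|.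
  move=> jn; rewrite /w /xk; case: eqP => [->|_].
    rewrite (leq_trans (ltnW jn) nk) !mul1r.
    rewrite (_ : _ - _ = (2 - bit_sign R j k ^+ 2) * X i); last by ring.
    by rewrite /bit_sign sqrr_sign normrM (_ : 2 - 1 = 1) ?normr1 ?mul1r//; ring.
  rewrite mul0r mulr0 sub0r normrN !normrM !norm_bit_sign mul1r mulr1.
  by case: leqP; rewrite ?normr1 ?normr0.
have w2 j : (j < n)%N -> bounded_by (w j) 2.
  move=> jn i; apply: le_trans (wX _ _ jn) _; apply: le_trans (_ : 1 <= _); last by lra.
  by apply: le_trans (X1 i); case: leqP => _; rewrite ?mul1r ?mul0r.
have := @norm_J_sum n (fun j => `|a j|) w (fun j => s + e j) w2
  (fun j jn => block_le (fun i => wX _ _ jn)).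
have Fw : (fun i => \sum_(j < n) `|a j| * w j i) =
    fun i => (2 * A) * xk i + (-1) * comb (head n a) i.
  apply/funext => i; rewrite /w /comb (_ : \sum_(j < (kappa i).+1) _ =
    \sum_(j < n) (j < (kappa i).+1)%:R * (a j * bit_sign R j (kappa i))); last first.
    rewrite -(sum_ord_swap _ _ (fun j => a j * bit_sign R j (kappa i))).
    apply: eq_bigr => j _; rewrite /head.
    by case: ltnP; rewrite ?mul1r ?mul0r.
  rewrite /A mulN1r [X in - X]mulr_sumr -sumrN mulr_sumr mulr_suml -big_split.
  by apply: eq_bigr => j _ /=; rewrite {3}(abit j)// ltnS; ring.
have xk1 : bounded_by xk 1.
  move=> i; rewrite /xk normrM; apply: le_trans (X1 i); rewrite ler_piMl//.
  by case: eqP; rewrite ?normr1 ?normr0.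
have hb : bounded_by (comb (head n a)) A.
  apply: comb_bounded => m; have -> : \sum_(j < m) `|head n a j| =
      \sum_(j < m) (j < n)%:R * `|a j|.
    apply: eq_bigr => j _; rewrite /head.
    by case: ltnP; rewrite ?mul1r ?mul0r ?normr0.
  rewrite (sum_ord_swap _ _ (fun j => `|a j|)); apply: ler_sum => j _.
  by case: ltnP; rewrite ?mul1r ?mul0r.
rewrite Fw; under eq_bigr do rewrite normr_id.
case: HJ => _ lin _ _; rewrite (lin _ _ _ (1 + A)); first last.
- by move=> i; rewrite mulN1r normrN; apply: le_trans (hb i) _; rewrite lerDr.
- by move=> i; apply: le_trans (xk1 i) _; rewrite lerDl.
rewrite (J_scale _ hb) scaleN1r => H1.
have H2 : 2 * A * `|J xk| <= `|J (comb (head n a))| + \sum_(j < n) `|a j| * (s + e j).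
  have -> : 2 * A * `|J xk| = `|(2 * A) *: J xk| by rewrite normrZ ger0_norm ?mulr_ge0.
  apply: le_trans (lerD (lexx _) H1); rewrite -[X in `|X|](subrKC (J (comb (head n a)))).
  exact: ler_normD.
have HA : 2 * A * (s - d / (2 * A + 1)) <= 2 * A * `|J xk| by rewrite ler_wpM2l// mulr_ge0.
have Hd : 2 * A * (d / (2 * A + 1)) <= d.
  rewrite mulrCA ler_piMr ?(ltW d0)// ler_pdivrMr// mul1r; lra.
have -> : \sum_(j < n) `|a j| * (s - e j) = 2 * A * s - \sum_(j < n) `|a j| * (s + e j).
  rewrite /A mulr_sumr mulr_suml -sumrB; apply: eq_bigr => j _; ring.
rewrite mulrBr in HA; lra.
Qed.

Lemma J_comb_ge a : abs_summable a ->
  forall n, \sum_(j < n) `|a j| * (s - e j) <= `|J (comb a)|.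
Proof.
move=> sa n; have be0 : 0 <= be.
  case: HJ => _ _ /(_ (fun=> 0) 1) h _; rewrite -[be]mulr1.
  by apply: le_trans (h _) => // i; rewrite normr0.
apply/ler_addgt0Pr => d d0; have be1 : 0 < be + 1 by lra.
have [m tm] := sa _ (divr_gt0 d0 be1).
have e1 : be * (d / (be + 1)) <= d.
  rewrite mulrCA ler_piMr ?(ltW d0)// ler_pdivrMr// mul1r; lra.
have := J_comb_ge_head (maxn n m) a.
have : \sum_(j < n) `|a j| * (s - e j) <= \sum_(j < maxn n m) `|a j| * (s - e j).
  rewrite (big_ord_widen _ (fun j => `|a j| * (s - e j)) (leq_maxl n m)) big_mkcond.
  by apply: ler_sum => j _; case: ifP => // _; rewrite mulr_ge0// subr_ge0.
have : `|J (comb (tail (maxn n m) a))| <= be * (d / (be + 1)).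
  apply: J_comb_le0 => k; apply: le_trans (tm k); apply: ler_sum => j _.
  rewrite /tail geq_max; case: (leqP m j) => _; rewrite ?andbT ?andbF.
    by case: ifP => _; rewrite ?normr0.
  by rewrite normr0.
have -> : J (comb (head (maxn n m) a)) = J (comb a) - J (comb (tail (maxn n m) a)).
  by rewrite (J_comb_head_tail (maxn n m) sa) addrK.
have := ler_normB (J (comb a)) (J (comb (tail (maxn n m) a))).
lra.
Qed.

(** The triangle inequality over the [z_j], each of which lives on the blocks
    from [j] on; for infinitely many coefficients, the tail is controlled by the
    continuity of [J]. *)
Lemma J_comb_le a C : abs_summable a ->
  (forall n, \sum_(j < n) `|a j| * (s + e j) <= C) -> `|J (comb a)| <= C.
Proof.
move=> sa aC; have be0 : 0 <= be.
  case: HJ => _ _ /(_ (fun=> 0) 1) h _; rewrite -[be]mulr1.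
  by apply: le_trans (h _) => // i; rewrite normr0.
apply/ler_addgt0Pr => d d0; have be1 : 0 < be + 1 by lra.
have [m tm] := sa _ (divr_gt0 d0 be1).
have e1 : be * (d / (be + 1)) <= d.
  rewrite mulrCA ler_piMr ?(ltW d0)// ler_pdivrMr// mul1r; lra.
rewrite (J_comb_head_tail m sa) (le_trans (ler_normD _ _))// lerD//; last first.
  exact: le_trans (J_comb_le0 tm) _.
apply: le_trans (aC m).
pose z j i := (j <= kappa i)%:R * bit_sign R j (kappa i) * X i.
have zX j i : `|z j i| <= (j <= kappa i)%:R * `|X i|.
  by rewrite /z !normrM norm_bit_sign mulr1; case: leqP; rewrite ?normr1 ?normr0.
have -> : comb (head m a) = fun i => \sum_(j < m) a j * z j i.
  apply/funext => i; rewrite /comb (_ : \sum_(j < (kappa i).+1) _ =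
    \sum_(j < m) (j < (kappa i).+1)%:R * (a j * bit_sign R j (kappa i))).
    by rewrite mulr_sumr; apply: eq_bigr => j _; rewrite /z ltnS; ring.
  rewrite -(sum_ord_swap _ _ (fun j => a j * bit_sign R j (kappa i))).
  apply: eq_bigr => j _; rewrite /head.
  by case: ltnP; rewrite ?mul1r ?mul0r.
apply: (@norm_J_sum m a z (fun j => s + e j)) => j _; last exact: block_le.
move=> i; apply: le_trans (zX _ _) _; apply: le_trans (_ : 1 <= _); last by lra.
by apply: le_trans (X1 i); case: leqP => _; rewrite ?mul1r ?mul0r.
Qed.

End RademacherL1.

(** * A fixed point free nonexpansive map *)

Lemma div_nat_small (R : realType) (C d : R) : 0 < d ->
  exists K, forall k, (K <= k)%N -> C / k.+1%:R <= d.
Proof.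
move=> d0; have C0 : 0 <= `|C| / d by rewrite divr_ge0 ?normr_ge0 ?ltW.
exists (Num.bound (`|C| / d)) => k Kk; rewrite ler_pdivrMr ?ltr0n//.
apply: le_trans (ler_norm C) _; rewrite mulrC -ler_pdivrMr//.
apply: le_trans (ltW (archi_boundP C0)) _.
by rewrite ler_nat (leq_trans Kk).
Qed.

Lemma le0_div_nat (R : realType) (x C : R) :
  (forall m, x <= C / m.+1%:R) -> x <= 0.
Proof.
move=> xC; apply/ler_addgt0Pr => d d0; rewrite add0r.
by have [m /(_ _ (leqnn m))] := div_nat_small C d0; exact: le_trans.
Qed.

Section Simplex.
Variable R : realType.
Implicit Types (a b : nat -> R).

(** The probability sequences.  Total mass [1] is split into two one-sided
    conditions on partial sums, convenient for limits. *)
Definition simplex : set (nat -> R) := [set a : nat -> R |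
  [/\ forall j, 0 <= a j, forall n, \sum_(j < n) a j <= 1 &
      forall d, 0 < d -> exists n, 1 - d <= \sum_(j < n) a j]].

Definition shift a : nat -> R := fun j => if j is i.+1 then a i else 0.

Lemma sum_ord_mono a m n : (forall j, 0 <= a j) -> (m <= n)%N ->
  \sum_(j < m) a j <= \sum_(j < n) a j.
Proof.
move=> a0 mn; rewrite (big_ord_widen _ a mn) big_mkcond.
by apply: ler_sum => j _; case: ifP.
Qed.

Lemma sum_shift a n : \sum_(j < n.+1) shift a j = \sum_(j < n) a j.
Proof. by rewrite big_ord_recl add0r. Qed.

Lemma simplex_abs_summable a : simplex a -> abs_summable a.
Proof.
move=> [a0 a1 al] d /al[n nd]; exists n => m; pose N := maxn m n.
have := a1 N; suff : \sum_(j < m) `|tail n a j| + \sum_(j < n) a j <= \sum_(j < N) a j.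
  move: nd; lra.
rewrite (big_ord_widen _ (fun j => `|tail n a j|) (leq_maxl m n)) big_mkcond.
rewrite [X in _ + X](big_ord_widen _ a (leq_maxr m n)) [X in _ + X]big_mkcond.
rewrite -big_split; apply: ler_sum => j _ /=; rewrite /tail.
by case: (j < m)%N; case: leqP => _; rewrite ?normr0 ?addr0 ?add0r// ger0_norm.
Qed.

Lemma simplex_shift a : simplex a -> simplex (shift a).
Proof.
move=> [a0 a1 al]; split; first by case.
  by case=> [|n]; rewrite ?big_ord0// sum_shift.
by move=> d /al[n nd]; exists n.+1; rewrite sum_shift.
Qed.

Lemma simplex_conv a b (l : R) : 0 <= l <= 1 -> simplex a -> simplex b ->
  simplex (fun j => l * a j + (1 - l) * b j).
Proof.
move=> /andP[l0 l1] [a0 a1 aL] [b0 b1 bL]; have l2 : 0 <= 1 - l by lra.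
have S n : \sum_(j < n) (l * a j + (1 - l) * b j) =
    l * \sum_(j < n) a j + (1 - l) * \sum_(j < n) b j.
  by rewrite big_split !mulr_sumr.
split.
- by move=> j; rewrite addr_ge0// mulr_ge0.
- move=> n; rewrite S; have := ler_wpM2l l0 (a1 n); have := ler_wpM2l l2 (b1 n); lra.
- move=> d d0; have [m ma] := aL _ d0; have [n nb] := bL _ d0.
  exists (maxn m n); rewrite S.
  have ha := le_trans ma (sum_ord_mono a0 (leq_maxl m n)).
  have hb := le_trans nb (sum_ord_mono b0 (leq_maxr m n)).
  have := ler_wpM2l l0 ha; have := ler_wpM2l l2 hb; lra.
Qed.

Lemma simplex_delta : simplex (fun j => (j == 0%N)%:R).
Proof.
split=> [j|n|d d0]; first by rewrite ler0n.
- case: n => [|n]; rewrite ?big_ord0// big_ord_recl big1 ?addr0// => i _.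
- by exists 1%N; rewrite big_ord1 /=; lra.
Qed.

Lemma simplex_shift_neq a : simplex a -> ~ (forall j, a j = shift a j).
Proof.
move=> [_ _ aL] ash; have a0 j : a j = 0 by elim: j => [|j IH]; rewrite ash.
have [n] := aL 2^-1 ltac:(lra); rewrite big1 => [|j _]; last exact: a0.
lra.
Qed.

(** The simplex is closed under limits in the norm of [l^1]; an explicit rate
    of convergence makes the limit a supremum. *)
Lemma simplex_closed (A : nat -> nat -> R) (q : nat -> R) :
  (forall d, 0 < d -> exists m, q m <= d) ->
  (forall m, simplex (A m)) ->
  (forall m l n, \sum_(j < n) `|A m j - A l j| <= q m + q l) ->
  exists2 a, simplex a & forall m n, \sum_(j < n) `|A m j - a j| <= q m.
Proof.
move=> q0 sA AC.
have le_q0 x c : 0 <= c -> (forall m, x <= c * q m) -> x <= 0.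
  move=> c0 xq; apply/ler_addgt0Pr => d d0; rewrite add0r.
  have c1 : 0 < c + 1 by lra.
  have [m qm] := q0 _ (divr_gt0 d0 c1); apply: le_trans (xq m) _.
  apply: le_trans (ler_wpM2l c0 qm) _.
  by rewrite mulrCA ler_piMr ?(ltW d0)// ler_pdivrMr// mul1r lerDl.
have le_q1 x : (forall m, x <= q m) -> x <= 0.
  by move=> xq; apply: (le_q0 _ 1) => // m; rewrite mul1r.
have AC1 m l j : `|A m j - A l j| <= q m + q l.
  apply: le_trans (AC m l j.+1); rewrite big_ord_recr /= lerDr.
  by apply: sumr_ge0.
pose B j := range (fun m => A m j - q m).
pose a j := sup (B j).
have aA m j : `|A m j - a j| <= q m.
  have ub l : ubound (B j) (A l j + q l).
    by move=> _ [k _ <-]; have := AC1 k l j; rewrite ler_norml => /andP[]; lra.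
  have h1 : a j <= A m j + q m.
    by apply: ge_sup => //; exists (A 0%N j - q 0%N), 0%N.
  have h2 : A m j - q m <= a j.
    by apply: ub_le_sup; [exists (A 0%N j + q 0%N); exact: ub|exists m].
  by rewrite ler_norml; apply/andP; split; lra.
have aS m n : \sum_(j < n) `|A m j - a j| <= q m.
  rewrite -subr_le0; apply: (le_q0 _ (1 + n%:R)) => [|l].
    by rewrite addr_ge0.
  have h1 : \sum_(j < n) `|A l j - a j| <= n%:R * q l.
    apply: (@le_trans _ _ (\sum_(j < n) q l)); first by apply: ler_sum => j _; exact: aA.
    by rewrite sumr_const card_ord mulr_natl.
  have h2 : \sum_(j < n) `|A m j - a j| <=
      \sum_(j < n) `|A m j - A l j| + \sum_(j < n) `|A l j - a j|.
    rewrite -big_split; apply: ler_sum => j _ /=.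
    rewrite (_ : A m j - a j = (A m j - A l j) + (A l j - a j)); last by ring.
    exact: ler_normD.
  have := AC m l n; rewrite mulrDl; lra.
have aS' m n : `|\sum_(j < n) A m j - \sum_(j < n) a j| <= q m.
  by rewrite -sumrB; apply: le_trans (aS m n); exact: ler_norm_sum.
exists a => //; split.
- move=> j; rewrite -oppr_le0; apply: le_q1 => m.
  by have [/(_ j) + _ _] := sA m; have := aA m j; rewrite ler_norml => /andP[]; lra.
- move=> n; rewrite -subr_le0; apply: le_q1 => m.
  by have [_ /(_ n) + _] := sA m; have := aS' m n; rewrite ler_norml => /andP[]; lra.
- move=> d d0; have d2 : 0 < d / 2 by lra.
  have [m mC] := q0 _ d2.
  have [_ _ /(_ _ d2)[n nd]] := sA m; exists n.
  by have := aS' m n; rewrite ler_norml => /andP[]; lra.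
Qed.
End Simplex.
Arguments simplex {R}.

Section NoFixedPoint.
Variables (R : realType) (E : normedModType R) (J : (nat -> R) -> E).
Variables (al be : R).

(** The weights [lam j = 1 + 2 ^- j] decrease to a positive limit.  The errors
    [e j] of the copy of [l^1] are chosen so much smaller than their differences
    that [lam j.+1 * (s + e j.+1) <= lam j * (s - e j)]: the upper estimate for
    a shifted combination is below the lower estimate for the original one. *)
Theorem linfty_copy_not_fpp : linfty_copy J al be -> ~ fixed_point_property E.
Proof.
move=> HJ fpp.
have al0 : 0 < al by case: HJ.
pose h j : R := (2^-1) ^+ j.
have h0 j : 0 < h j by rewrite exprn_gt0// invr_gt0.
have h1 j : h j <= 1 by rewrite exprn_ile1// ?invr_ge0// invf_le1// ler1n.
have hS j : h j.+1 = h j / 2 by rewrite /h exprS mulrC.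
pose e j := al * h j / 16.
have e0 j : 0 < e j by rewrite !mulr_gt0.
have elim (d : R) : 0 < d -> exists K, forall k, (K <= k)%N -> e k <= d.
  move=> /(div_nat_small al)[K HK]; exists K => k /HK; apply: le_trans.
  rewrite /e -mulrA ler_wpM2l ?(ltW al0)//.
  apply: (@le_trans _ _ (h k)); first by have := h0 k; lra.
  rewrite /h exprVn lef_pV2 ?posrE ?exprn_gt0 ?ltr0n// -natrX ler_nat.
  exact: ltn_expl.
have [s [X [kappa [als X1 ble bge]]]] := asymptotic_blocks HJ e0 elim.
have es j : e j <= s by rewrite /e; have := h1 j; have := h0 j; nra.
have {}e0 j := ltW (e0 j).
have hal j : 0 <= al * h j by rewrite mulr_ge0 ?ltW.
have hals j : al * h j <= s * h j by rewrite ler_wpM2r// ltW.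
have ahh j : al * h j * h j <= al * h j by rewrite ler_piMr.
pose lam j := 1 + h j.
have lam0 j : 0 <= lam j by rewrite /lam addr_ge0// ltW.
have lam2 j : lam j <= 2 by rewrite /lam; have := h1 j; lra.
have lamS j : lam j.+1 * (s + e j.+1) <= lam j * (s - e j).
  rewrite /lam /e hS; have := hal j; have := hals j; have := ahh j; have := h0 j; lra.
have lamL j : al / 2 <= lam j * (s - e j).
  rewrite /lam /e; have := hal j; have := hals j; have := ahh j; have := h1 j.
  have : 0 <= al * (1 - h j) by rewrite mulr_ge0 ?subr_ge0// ltW.
  rewrite mulrBr; lra.
pose wt (a : nat -> R) : nat -> R := fun j => lam j * a j.
pose Phi a := J (comb X kappa (wt a)).
have wtS a : abs_summable a -> abs_summable (wt a).
  move=> sa; apply: (abs_summable_le (ler0n R 2) sa) => j.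
  by rewrite /wt normrM (ger0_norm (lam0 j)) ler_wpM2r.
have PhiL c a b : abs_summable a -> abs_summable b ->
    Phi (fun j => c * a j + b j) = c *: Phi a + Phi b.
  move=> sa sb; rewrite /Phi -(J_comb_linear HJ kappa X1); try exact: wtS.
  by congr (J (comb _ _ _)); apply/funext => j; rewrite /wt; ring.
have PhiB a b : abs_summable a -> abs_summable b ->
    Phi (fun j => a j - b j) = Phi a - Phi b.
  move=> sa sb; rewrite [RHS]addrC -scaleN1r -PhiL//; congr Phi.
  by apply/funext => j; ring.
have Phi_ge a n : abs_summable a -> \sum_(j < n) `|a j| * (al / 2) <= `|Phi a|.
  move=> /wtS sa; have := J_comb_ge HJ X1 ble bge es sa n; apply: le_trans.
  apply: ler_sum => j _; rewrite /wt normrM (ger0_norm (lam0 j)).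
  by rewrite [X in _ <= X * _]mulrC -mulrA ler_wpM2l.
have Phi_le a C : partial_sums_le a C -> `|Phi a| <= be * (2 * C).
  move=> aC; apply: (J_comb_le0 HJ kappa X1) => n; rewrite /wt.
  apply: le_trans (_ : \sum_(j < n) 2 * `|a j| <= _).
    by apply: ler_sum => j _; rewrite normrM (ger0_norm (lam0 j)) ler_wpM2r.
  by rewrite -mulr_sumr ler_wpM2l.
have shiftS (a : nat -> R) : abs_summable a -> abs_summable (shift a).
  move=> sa d /sa[n na]; exists n.+1 => -[|m].
    by rewrite big_ord0; apply: le_trans (na 0%N); rewrite big_ord0.
  by rewrite big_ord_recl /tail /= normr0 add0r; exact: na.
have Phi_shift (a : nat -> R) : abs_summable a -> `|Phi (shift a)| <= `|Phi a|.
  move=> sa; have H := J_comb_le HJ X1 ble (wtS _ (shiftS _ sa)).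
  apply: H => -[|n].
    by rewrite big_ord0.
  rewrite big_ord_recl /wt /= mulr0 normr0 mul0r add0r.
  have := J_comb_ge HJ X1 ble bge es (wtS _ sa) n; apply: le_trans.
  apply: ler_sum => j _; rewrite /wt /= !normrM !(ger0_norm (lam0 _)).
  by rewrite mulrAC [leRHS]mulrAC ler_wpM2r.
pose K := Phi @` simplex.
have [g gP] : {g : E -> nat -> R & forall w, K w -> simplex (g w) /\ Phi (g w) = w}.
  apply: (@choice E (nat -> R) (fun w a => K w -> simplex a /\ Phi a = w)) => w.
  have [[a sa <-]|nK] := pselect (K w); first by exists a.
  by exists (fun=> 0).
pose S w := Phi (shift (g w)).
have [] := fpp K _ _ _ _ S.
- by exists (Phi (fun j => (j == 0%N)%:R)), (fun j => (j == 0%N)%:R) => //; exact: simplex_delta.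
- (* The lower estimate makes the coefficients of points of [K] tending to [w]
     converge in [l^1]. *)
  move=> w clw.
  have /choice[A AP] (m : nat) : exists a : nat -> R, simplex a /\ `|w - Phi a| <= 1 / m.+1%:R.
    have [|_ [[a sa <-]]] := clw (ball w (1 / m.+1%:R)).
      by apply: nbhsx_ballx; rewrite divr_gt0.
    by rewrite -ball_normE /= => /ltW wa; exists a.
  have sA m : abs_summable (A m) by apply: simplex_abs_summable; case: (AP m).
  have [d /(div_nat_small (2 / al))[m mC]|m|m l n|a sa Aa] :=
    @simplex_closed _ A (fun m => 2 / al / m.+1%:R).
  + by exists m; exact: mC.
  + by case: (AP m).
  + have := Phi_ge _ n (abs_summableB (sA m) (sA l)).
    rewrite -mulr_suml -ler_pdivlMr ?divr_gt0// PhiB// => /le_trans; apply.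
    rewrite ler_pdivrMr ?divr_gt0//.
    rewrite (_ : _ * (al / 2) = 1 / m.+1%:R + 1 / l.+1%:R); last first.
      by field; rewrite (gt_eqF al0) !nat1r !pnatr_eq0.
    rewrite (_ : Phi _ - _ = (w - Phi (A l)) - (w - Phi (A m))); last first.
      by rewrite opprB [RHS]addrC addrA subrK.
    rewrite [leRHS]addrC (le_trans (ler_normB _ _))// lerD//; first by case: (AP l).
    by case: (AP m).
  + exists a => //; apply/eqP; rewrite eq_sym -subr_eq0 -normr_le0.
    apply: (@le0_div_nat _ _ (1 + be * (2 * (2 / al)))) => m.
    have := Phi_le (fun j => A m j - a j) _ (Aa m); rewrite PhiB//; last exact: simplex_abs_summable.
    case: (AP m) => _ h2 h3; rewrite mulrDl.
    rewrite (_ : be * (2 * (2 / al)) / _ = be * (2 * (2 / al / m.+1%:R))); last by rewrite !mulrA.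
    rewrite (_ : w - Phi a = (w - Phi (A m)) + (Phi (A m) - Phi a)); last by rewrite addrA subrK.
    by rewrite (le_trans (ler_normD _ _))// lerD.
- exists (be * 2); split; first exact: num_real.
  move=> M bM _ [a [a0 a1 _] <-]; apply: le_trans (ltW bM).
  rewrite -[2]mulr1; apply: (Phi_le _ 1) => n; apply: le_trans (a1 n).
  by apply: ler_sum => j _; rewrite ger0_norm.
- move=> x y l; rewrite !inE => -[a sa <-] [b sb <-].
  have [sa' sb'] := (simplex_abs_summable sa, simplex_abs_summable sb).
  exists (fun j => l%:num * a j + (1 - l%:num) * b j).
    by apply: simplex_conv => //; rewrite ge0 le1.
  rewrite (_ : (fun _ => _) = fun j => l%:num * (a j - b j) + b j); last first.
    by apply/funext => j; ring.
  rewrite PhiL ?PhiB//; last exact: abs_summableB.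
  by rewrite /conv /= scalerBr scalerBl scale1r addrAC -addrA.
- by move=> w /gP[sg _]; exists (shift (g w)) => //; exact: simplex_shift.
- move=> v w /gP[sv gv] /gP[sw gw].
  have [sa sb] := (simplex_abs_summable sv, simplex_abs_summable sw).
  rewrite /S -PhiB; [|exact: shiftS..].
  rewrite -{2}gv -{2}gw -PhiB//.
  apply: le_trans (Phi_shift _ (abs_summableB sa sb)).
  rewrite (_ : shift (fun j => g v j - g w j) =
    fun j => shift (g v) j - shift (g w) j)//.
  by apply/funext => -[|j] /=; rewrite ?subrr.
- move=> w Kw Sw; have [sg gw] := gP w Kw.
  have sa := simplex_abs_summable sg.
  apply: (simplex_shift_neq sg) => j; apply/eqP; rewrite -subr_eq0 -normr_le0.
  have := Phi_ge _ j.+1 (abs_summableB sa (shiftS _ sa)).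
  rewrite PhiB//; last exact: shiftS.
  rewrite -/(S w) Sw gw subrr normr0 -mulr_suml pmulr_lle0 ?divr_gt0//.
  by apply: le_trans; rewrite big_ord_recr /= lerDr sumr_ge0.
Qed.
End NoFixedPoint.

(** * Measurable functions representing elements of a Banach function space *)

Section AlmostEverywhere.
Context {R : realType} {I : interval R}.
Local Notation mu := (leb_on I).

Lemma measurable_lebR (A : set R) : measurable (A : set (measurableTypeR R)) ->
  measurable (A : set (@lebR R)).
Proof. exact: sub_caratheodory. Qed.

Lemma measurable_fun_lebR (f : R -> R) :
  measurable_fun setT (f : measurableTypeR R -> R) ->
  measurable_fun setT (f : @lebR R -> R).
Proof.
move=> mf _ Y mY; rewrite setTI; apply: measurable_lebR.
by have := mf measurableT Y mY; rewrite setTI.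
Qed.

Lemma leb_itv (i : interval R) : leb ([set` i] : set (@lebR R)) =
  (if (i.1 < i.2)%E then (i.2 : \bar R) - (i.1 : \bar R) else 0)%E.
Proof. exact: lebesgue_measure_itv. Qed.

Lemma ae_leb_on (P : set R) (D : set R) : D `<=` [set` I] ->
  {ae mu, forall x, P x} -> {ae leb, forall x : @lebR R, D x -> P x}.
Proof.
move=> DI [N [mN N0 PN]]; exists (N `&` [set` I]); split.
- by apply: measurableI => //; exact: measurable_lebR_itv.
- exact: N0.
- move=> x /= nDP; split; first by apply: PN => Px; apply: nDP.
  by apply: contrapT => nI; apply: nDP => /DI.
Qed.

Lemma leb_on_ae_le (A B : set (@lebR R)) : measurable A -> measurable B ->
  {ae mu, forall x, A x -> B x} -> (mu A <= mu B)%E.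
Proof.
move=> mA mB AB; have := @ae_ge0_le_integral _ _ _ mu setT measurableT
  (EFin \o \1_A) (EFin \o \1_B).
rewrite !integral_indic// !setIT; apply.
- by move=> x _; rewrite lee_fin.
- by apply/measurable_EFinP; exact: measurable_indic.
- by move=> x _; rewrite lee_fin.
- by apply/measurable_EFinP; exact: measurable_indic.
- apply: filterS AB => x AB _; rewrite lee_fin !indicE ler_nat.
  by case: (boolP (x \in A)) => //; rewrite inE => /AB Bx; rewrite mem_set.
Qed.

Lemma leb_on_ae_eq (A B : set (@lebR R)) : measurable A -> measurable B ->
  {ae mu, forall x, A x <-> B x} -> mu A = mu B.
Proof.
move=> mA mB AB; apply/eqP; rewrite eq_le; apply/andP; split;
  by apply: leb_on_ae_le => //; apply: filterS AB => x [].
Qed.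

Lemma measurable_gt (f : @lebR R -> R) (s : R) : measurable_fun setT f ->
  measurable [set x | s < `|f x|].
Proof.
move=> mf; have : measurable_fun setT (fun x => `|f x|) by exact: measurableT_comp.
move=> /(_ measurableT `]s, +oo[%classic (measurable_itv _)); rewrite setTI.
by congr (measurable _); apply/seteqP; split => x /=; rewrite in_itv/= andbT.
Qed.

Lemma measurable_L0_fun (f : L0_on I) : measurable_fun setT (L0_fun f).
Proof. exact: measurable_funPT. Qed.

End AlmostEverywhere.

Section Representatives.
Context {R : realType} {I : interval R} (X : banachFunctionSpace I).
Local Notation mu := (leb_on I).
Implicit Types (u v : @lebR R -> R) (x y : X).

(** Elements of [X] are handled through functions defined everywhere, on which
    pointwise constructions can be performed. *)
Definition represents x u :=
  {ae mu, forall t, L0_fun (bfs_incl X x) t = u t}.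

Lemma represents_ae x u v : represents x u -> {ae mu, forall t, u t = v t} ->
  represents x v.
Proof. by apply: filterS2 => t -> . Qed.

Lemma represents_inj x y u : represents x u -> represents y u -> x = y.
Proof.
move=> xu yu; apply: (@bfs_incl_inj _ _ X); apply: L0_eqP.
by apply: filterS2 xu yu => t -> ->.
Qed.

Lemma represents_linear a x y u v : represents x u -> represents y v ->
  represents (a *: x + y) (fun t => a * u t + v t).
Proof.
move=> xu yv; rewrite /represents linearP.
have := L0_addE (a *: bfs_incl X x) (bfs_incl X y).
have := L0_scaleE a (bfs_incl X x) => h1 h2.
apply: filterS2 (filterI h1 h2) (filterI xu yv) => t [e1 e2] [<- <-].
exact: etrans e2 (congr1 (+%R^~ _) e1).
Qed.

Lemma represents_sub x y u v : represents x u -> represents y v ->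
  represents (x - y) (fun t => u t - v t).
Proof.
move=> xu yv; rewrite addrC -scaleN1r; apply: represents_ae (represents_linear (-1) yv xu) _.
by apply: nearW => t; rewrite mulN1r addrC.
Qed.

Lemma represents_ideal u y v : measurable_fun setT u -> represents y v ->
  {ae mu, forall t, `|u t| <= `|v t|} -> exists2 x, represents x u & `|x| <= `|y|.
Proof.
move=> mu_ yv uv.
pose f : {mfun @lebR R >-> R} := mfun_Sub (mem_set mu_).
have fE := L0_classK mu f.
have [|x xf xy] := @bfs_ideal _ _ X (L0_class mu f) y.
  by apply: filterS3 yv uv fE => t -> + -> .
by exists x => //; rewrite /represents xf; exact: fE.
Qed.

Lemma represents_symmetric u y v : symmetric_space X ->
  measurable_fun setT u -> measurable_fun setT v -> represents y v ->
  (forall s, 0 < s -> mu [set t | s < `|u t|] = mu [set t | s < `|v t|]) ->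
  exists2 x, represents x u & `|x| = `|y|.
Proof.
move=> symX mu_ mv yv uv.
pose f : {mfun @lebR R >-> R} := mfun_Sub (mem_set mu_).
have fE := L0_classK mu f.
have [|x xf xy] := symX (L0_class mu f) y; last first.
  by exists x => //; rewrite /represents xf; exact: fE.
move=> s s0; transitivity (mu [set t | s < `|u t|]).
  apply: leb_on_ae_eq;
    [by apply: measurable_gt; exact: measurable_L0_fun|exact: measurable_gt|].
  by apply: filterS fE => t /= ->.
rewrite uv//; apply: leb_on_ae_eq;
  [exact: measurable_gt|by apply: measurable_gt; exact: measurable_L0_fun|].
by apply: filterS yv => t /= ->.
Qed.

Lemma represents0 : represents 0 (fun=> 0).
Proof. by rewrite /represents linear0; exact: L0_zeroE. Qed.

Lemma represents_le x y u v : represents x u -> represents y v ->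
  {ae mu, forall t, `|u t| <= `|v t|} -> `|x| <= `|y|.
Proof.
move=> xu yv uv; have [|z zf zy] := @bfs_ideal _ _ X (bfs_incl X x) y.
  by apply: filterS3 xu yv uv => t -> ->.
by have -> : x = z by apply: (@bfs_incl_inj _ _ X).
Qed.

End Representatives.

(** * Integral operators with nonnegative kernel *)

Section PositiveOperators.
Context {R : realType} (I : interval R).
Local Notation mu := (leb_on I).
Implicit Types (T : (@lebR R -> R) -> @lebR R -> \bar R).
Implicit Types (f g : @lebR R -> R).
Local Open Scope ereal_scope.

(** The common shape of the two averaging operators: at each point, the
    integral against a nonnegative weight over a part of [I]. *)
Definition positive_integral_operator T : Prop :=
  forall x : R, [set` I] x -> (0 < x)%R ->
  exists (c : R) (D : set (@lebR R)) (w : @lebR R -> R),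
  [/\ (0 <= c)%R, measurable D /\ D `<=` [set` I], measurable_fun setT w,
      (forall t, D t -> (0 <= w t)%R) &
      forall f, T f x = c%:E * \int[leb]_(t in D) (f t * w t)%:E].

Lemma cesaro_positive : (I = `[0, 1] \/ I = `[0, +oo[)%R ->
  positive_integral_operator cesaro_op.
Proof.
move=> HI x Ix x0; exists (x^-1)%R, `[0%R, x]%classic, (cst 1%R); split.
- by rewrite invr_ge0 ltW.
- split; first exact: measurable_lebR_itv.
  move=> t /=; move: Ix; case: HI => -> /=; rewrite !in_itv/= ?andbT.
    by move=> /andP[_ x1] /andP[-> /le_trans->].
  by move=> _ /andP[].
- exact: measurable_cst.
- by [].
- by move=> f; congr (_ * _); apply: eq_integral => t _ /=; rewrite mulr1.
Qed.

Lemma copson_positive : (I = `[0, 1] \/ I = `[0, +oo[)%R ->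
  positive_integral_operator (copson_op I).
Proof.
move=> HI x Ix x0.
exists 1%R, ([set` I] `&` `[x, +oo[), (fun t : @lebR R => (Num.max x (t : R))^-1)%R.
split.
- exact: ler01.
- by split; [apply: measurableI; exact: measurable_lebR_itv|move=> t []].
- apply: measurable_fun_lebR; apply: nonincreasing_measurable => // s t st.
  rewrite lef_pV2 ?posrE ?lt_max ?x0// ge_max !le_max lexx/= st orbT//.
- by move=> t _; rewrite invr_ge0 le_max (ltW x0).
- move=> f; rewrite mul1e /copson_op; apply: eq_integral => t.
  rewrite inE => -[_] /=; rewrite in_itv/= andbT => xt.
  by congr (_ * _)%:E; rewrite max_r.
Qed.

Section Properties.
Variables (T : (@lebR R -> R) -> @lebR R -> \bar R).
Hypothesis Tpos : positive_integral_operator T.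
Variables (x : R) (Ix : [set` I] x) (x0 : (0 < x)%R).

Lemma operator_ae_eq f g : measurable_fun setT f -> measurable_fun setT g ->
  {ae mu, forall t, f t = g t} -> T f x = T g x.
Proof.
move=> mf mg fg; have [c [D [w [c0 [mD DI] mw w0 TE]]]] := Tpos Ix x0.
rewrite !TE; congr (_ * _); apply: (ae_eq_integral _ _ mD).
- by apply/measurable_EFinP/measurable_funTS; exact: measurable_funM.
- by apply/measurable_EFinP/measurable_funTS; exact: measurable_funM.
- by apply: filterS (ae_leb_on DI fg) => t h Dt; rewrite h.
Qed.

Lemma operator_le f g : measurable_fun setT f -> measurable_fun setT g ->
  (forall t, 0 <= f t)%R -> (forall t, 0 <= g t)%R ->
  {ae mu, forall t, (f t <= g t)%R} -> T f x <= T g x.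
Proof.
move=> mf mg f0 g0 fg; have [c [D [w [c0 [mD DI] mw w0 TE]]]] := Tpos Ix x0.
rewrite !TE; apply: lee_wpmul2l; first by rewrite lee_fin.
apply: (ae_ge0_le_integral mD).
- by move=> t Dt; rewrite lee_fin mulr_ge0// w0.
- by apply/measurable_EFinP/measurable_funTS; exact: measurable_funM.
- by move=> t Dt; rewrite lee_fin mulr_ge0// w0.
- by apply/measurable_EFinP/measurable_funTS; exact: measurable_funM.
- by apply: filterS (ae_leb_on DI fg) => t h Dt; rewrite lee_fin ler_wpM2r ?w0// h.
Qed.

Lemma operator_ge0 f : (forall t, 0 <= f t)%R -> 0 <= T f x.
Proof.
move=> f0; have [c [D [w [c0 [mD DI] mw w0 TE]]]] := Tpos Ix x0.
rewrite TE mule_ge0 ?lee_fin// integral_ge0// => t Dt.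
by rewrite lee_fin mulr_ge0// w0.
Qed.

Lemma operatorD f g : measurable_fun setT f -> measurable_fun setT g ->
  (forall t, 0 <= f t)%R -> (forall t, 0 <= g t)%R ->
  T (fun t => f t + g t)%R x = T f x + T g x.
Proof.
move=> mf mg f0 g0; have [c [D [w [c0 [mD DI] mw w0 TE]]]] := Tpos Ix x0.
rewrite !TE -ge0_muleDr; [|by apply: integral_ge0 => t Dt; rewrite lee_fin mulr_ge0// w0..].
congr (_ * _); rewrite -(ge0_integralD _ mD).
- by apply: eq_integral => t _; rewrite mulrDl EFinD.
- by move=> t Dt; rewrite lee_fin mulr_ge0// w0.
- by apply/measurable_EFinP/measurable_funTS; exact: measurable_funM.
- by move=> t Dt; rewrite lee_fin mulr_ge0// w0.
- by apply/measurable_EFinP/measurable_funTS; exact: measurable_funM.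
Qed.

Lemma operatorZ (a : R) f : measurable_fun setT f -> (0 <= a)%R ->
  (forall t, 0 <= f t)%R -> T (fun t => a * f t)%R x = a%:E * T f x.
Proof.
move=> mf a0 f0; have [c [D [w [c0 [mD DI] mw w0 TE]]]] := Tpos Ix x0.
rewrite !TE muleCA; congr (_ * _); rewrite -(ge0_integralZl _ mD).
- by apply: eq_integral => t _; rewrite -mulrA EFinM.
- by apply/measurable_EFinP/measurable_funTS; exact: measurable_funM.
- by move=> t Dt; rewrite lee_fin mulr_ge0// w0.
- by rewrite lee_fin.
Qed.

(** Dominated convergence; finiteness of [T f x] provides the integrable bound. *)
Lemma operator_cvg0 f (A : nat -> set (@lebR R)) : measurable_fun setT f ->
  (forall t, 0 <= f t)%R -> (forall n, measurable (A n)) ->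
  (forall n, A n.+1 `<=` A n) -> \bigcap_n A n = set0 -> T f x < +oo ->
  (fun n => T (fun t => f t * \1_(A n) t)%R x) @ \oo --> 0.
Proof.
move=> mf f0 mA AS A0 Tfin; have [c [D [w [c0 [mD DI] mw w0 TE]]]] := Tpos Ix x0.
have [c00|cn0] := eqVneq c 0%R.
  rewrite (_ : (fun n => _) = cst 0); first exact: cvg_cst.
  by apply/funext => n; rewrite TE c00 mul0e.
have iD : \int[leb]_(t in D) (f t * w t)%:E < +oo.
  rewrite ltey; apply/eqP => ioo; move: Tfin.
  by rewrite TE ioo gt0_muley ?lte_fin ?lt_neqAle 1?eq_sym ?cn0// ltxx.
under eq_fun do rewrite TE.
rewrite -(mule0 c%:E); apply: cvgeZl => //.
rewrite (_ : 0 = \int[leb]_(t in D) cst 0 t); last by rewrite integral0.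
apply: (@dominated_cvg _ _ _ _ _ mD _ _ (fun t => (f t * w t)%:E)).
- move=> n; apply/measurable_EFinP/measurable_funTS; apply: measurable_funM mw.
  by apply: (measurable_funM mf); apply: measurable_indic; exact: mA.
- move=> t Dt; have [k nk] : exists k, ~ A k t.
    apply: contrapT => h; suff : (\bigcap_n A n) t by rewrite A0.
    by move=> n _; apply: contrapT => nA; apply: h; exists n.
  apply: cvg_near_cst; exists k => // n /= kn.
  rewrite indicE memNset ?mulr0 ?mul0r// => An; apply: nk.
  by elim: n kn An => [|n IH]; [rewrite leqn0 => /eqP ->|
    rewrite leq_eqVlt => /orP[/eqP ->//|/IH h /AS]].
- by [].
- apply/integrableP; split.
    by apply/measurable_EFinP/measurable_funTS; exact: measurable_funM.
  rewrite (eq_integral (fun t => (f t * w t)%:E))// => t; rewrite inE => Dt.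
  by rewrite gee0_abs// lee_fin mulr_ge0// w0.
- move=> n t Dt; rewrite lee_fin ger0_norm; last by rewrite !mulr_ge0// w0.
  by rewrite ler_wpM2r ?w0// ler_piMr// indicE lern1 leq_b1.
Qed.

End Properties.
End PositiveOperators.

(** * Images under the operator and disjoint sequences *)

Section OptimalDomain.
Context {R : realType} (I : interval R) (X : banachFunctionSpace I).
Hypothesis HI : I = `[0, 1]%R \/ I = `[0, +oo[%R.
Variable (T : (@lebR R -> R) -> @lebR R -> \bar R).
Hypothesis Tpos : positive_integral_operator I T.
Hypothesis Tbnd : bounded_on T X.
Local Notation mu := (leb_on I).
Implicit Types (u v : @lebR R -> R) (x y : X).

Lemma ae_pos : {ae mu, forall t : @lebR R, [set` I] t /\ 0 < (t : R)}.
Proof.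
exists (~` [set` I] `|` [set 0]); split.
- apply: measurableU; first by apply: measurableC; exact: measurable_lebR_itv.
  by apply: measurable_lebR; exact: measurable_set1.
- rewrite /leb_on/= /mrestr setIUl setICl set0U.
  have m0 : measurable ([set 0] : set (@lebR R)).
    by apply: measurable_lebR; exact: measurable_set1.
  apply: (subset_measure0 _ m0); [|exact: subIsetl|].
    by apply: measurableI => //; exact: measurable_lebR_itv.
  by have := @leb_itv R `[0, 0]; rewrite set_itv1/= ltxx.
- move=> t /= nt; have [It|] := pselect ([set` I] t); last by left.
  right; apply: contrapT => /= /eqP t0; apply: nt; split => //.
  by rewrite lt_neqAle eq_sym t0 /=; case: HI It => -> /=; rewrite in_itv/= => /andP[].
Qed.

Lemma ae_operator (P : @lebR R -> Prop) :
  (forall t : @lebR R, [set` I] t -> 0 < (t : R) -> P t) -> {ae mu, forall t, P t}.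
Proof. by move=> H; apply: filterS ae_pos => t [It t0]; exact: H. Qed.

Definition image_class u x :=
  {ae mu, forall t, (L0_fun (bfs_incl X x) t)%:E = T u t}.

Lemma image_class_exists u y : measurable_fun setT u -> represents y u ->
  exists x, image_class u x.
Proof.
move=> mu_ yu; case: Tbnd => M /(_ y)[x xT _]; exists x.
have H : {ae mu, forall t, T (L0_fun (bfs_incl X y)) t = T u t}.
  apply: ae_operator => t It t0.
  by apply: (operator_ae_eq Tpos It t0 _ mu_ yu); exact: measurable_L0_fun.
by apply: filterS2 xT H => t -> ->.
Qed.

Lemma image_class_ae u v x : measurable_fun setT u -> measurable_fun setT v ->
  {ae mu, forall t, u t = v t} -> image_class u x -> image_class v x.
Proof.
move=> mu_ mv uv ux; have H : {ae mu, forall t, T u t = T v t}.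
  by apply: ae_operator => t It t0; exact: (operator_ae_eq Tpos It t0 mu_ mv uv).
by apply: filterS2 ux H => t -> ->.
Qed.

Lemma image_class_inj u x y : image_class u x -> image_class u y -> x = y.
Proof.
move=> xu yu; apply: (@bfs_incl_inj _ _ X); apply: L0_eqP.
by apply: filterS2 xu yu => t <- [].
Qed.

Lemma image_class_le u v x y : measurable_fun setT u -> measurable_fun setT v ->
  (forall t, 0 <= u t) -> (forall t, 0 <= v t) -> {ae mu, forall t, u t <= v t} ->
  image_class u x -> image_class v y -> `|x| <= `|y|.
Proof.
move=> mu_ mv u0 v0 uv ux vy.
apply: (@represents_le _ _ _ x y (L0_fun (bfs_incl X x)) (L0_fun (bfs_incl X y))).
- exact: nearW.
- exact: nearW.
have H : {ae mu, forall t, 0 <= T u t <= T v t}%E.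
  apply: ae_operator => t It t0; apply/andP; split.
    exact: (operator_ge0 Tpos It t0 u0).
  exact: (operator_le Tpos It t0 mu_ mv u0 v0 uv).
apply: filterS3 ux vy H => t <- <-; rewrite !lee_fin => /andP[p q].
by rewrite !ger0_norm// (le_trans p).
Qed.

Lemma image_classD u v x y : measurable_fun setT u -> measurable_fun setT v ->
  (forall t, 0 <= u t) -> (forall t, 0 <= v t) ->
  image_class u x -> image_class v y -> image_class (fun t => u t + v t) (x + y).
Proof.
move=> mu_ mv u0 v0 ux vy.
have H : {ae mu, forall t, (T (fun t => u t + v t)%R t = T u t + T v t)%E}.
  by apply: ae_operator => t It t0; exact: (operatorD Tpos It t0 mu_ mv u0 v0).
rewrite /image_class linearD.
have := L0_addE (bfs_incl X x) (bfs_incl X y) => H2.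
apply: filterS3 (filterI ux vy) H H2 => t [<- <-] -> e.
by rewrite -EFinD -e.
Qed.

Lemma image_classZ a u x : measurable_fun setT u -> 0 <= a ->
  (forall t, 0 <= u t) ->
  image_class u x -> image_class (fun t => a * u t) (a *: x).
Proof.
move=> mu_ a0 u0 ux.
have H : {ae mu, forall t, (T (fun t => a * u t)%R t = a%:E * T u t)%E}.
  by apply: ae_operator => t It t0; exact: (operatorZ Tpos It t0 mu_ a0 u0).
rewrite /image_class linearZ.
have := L0_scaleE a (bfs_incl X x) => H2.
apply: filterS3 ux H H2 => t <- -> e.
by rewrite -EFinM -e.
Qed.

Section Localization.
Variables (h : @lebR R -> R) (yh : X).
Hypothesis mh : measurable_fun setT h.
Hypothesis h0 : forall t, 0 <= h t.
Hypothesis yhE : represents yh h.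

Definition localize (A : set (@lebR R)) : @lebR R -> R := fun t => h t * \1_A t.

Lemma measurable_localize A : measurable A -> measurable_fun setT (localize A).
Proof. by move=> mA; apply: (measurable_funM mh); exact: measurable_indic. Qed.

Lemma localize_ge0 A t : 0 <= localize A t.
Proof. by rewrite mulr_ge0// indicE. Qed.

Lemma localize_le A t : localize A t <= h t.
Proof. by rewrite ler_piMr// indicE lern1 leq_b1. Qed.

Lemma exists_localized_image : exists tau : set (@lebR R) -> X,
  forall A, measurable A -> image_class (localize A) (tau A).
Proof.
suff /choice[tau] : forall A : set (@lebR R), exists x,
    measurable A -> image_class (localize A) x by exists tau.
move=> A; have [mA|nA] := pselect (measurable A); last by exists 0.
have [|y yA _] := represents_ideal (measurable_localize mA) yhE.
  by apply: nearW => t; rewrite !ger0_norm ?localize_ge0// localize_le.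
by have [x xA] := image_class_exists (measurable_localize mA) yA; exists x.
Qed.

Variable tau : set (@lebR R) -> X.
Hypothesis tauE : forall A, measurable A -> image_class (localize A) (tau A).

Lemma tauB A B : measurable A -> measurable B -> B `<=` A ->
  tau (A `\` B) = tau A - tau B.
Proof.
move=> mA mB BA; apply/eqP; rewrite eq_sym subr_eq; apply/eqP.
have mAB := measurableD mA mB.
apply: (image_class_inj (tauE mA)).
apply: image_class_ae (image_classD _ _ _ _ (tauE mAB) (tauE mB)).
- by apply: measurable_funD; exact: measurable_localize.
- exact: measurable_localize.
- apply: nearW => t; rewrite /localize -mulrDr; congr (_ * _).
  rewrite !indicE in_setD; case: (boolP (t \in B)) => tB.
    have -> : t \in A by move: tB; rewrite !inE; exact: BA.
    by rewrite /= add0r.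
  by rewrite /= andbT addr0.
- exact: measurable_localize.
- exact: measurable_localize.
- exact: localize_ge0.
- exact: localize_ge0.
Qed.

(** An element of [X] which is not small along [A n] decreasing to the empty
    set is not small on some disjoint sequence: if [tau (A n)] is not a Cauchy
    sequence, the differences of consecutive sets of a subsequence will do; if it is one, its
    limit is [0] since it tends to [0] pointwise. *)
Lemma disjoint_not_small (A : nat -> set (@lebR R)) :
  (forall n, measurable (A n)) -> (forall n, A n.+1 `<=` A n) ->
  \bigcap_n A n = set0 -> ~ ((fun n => `|tau (A n)|) @ \oo --> (0 : R)) ->
  exists e (B : nat -> set (@lebR R)), [/\ 0 < e, forall n, measurable (B n),
    forall m n t, B m t -> B n t -> m = n & forall n, e <= `|tau (B n)|].
Proof.
move=> mA AS A0 nA.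
have Ale m n : (m <= n)%N -> A n `<=` A m.
  elim: n => [|n IH]; first by rewrite leqn0 => /eqP ->.
  by rewrite leq_eqVlt => /orP[/eqP->//|] /IH ih t /AS/ih.
have [Hc|Hc] := pselect (forall e, 0 < e -> exists n, forall m, (n <= m)%N ->
    `|tau (A n) - tau (A m)| < e); last first.
  have [e [e0 /= He]] : exists e, 0 < e /\ forall n, exists2 m, (n <= m)%N &
      e <= `|tau (A n) - tau (A m)|.
    apply: contrapT => h1; apply: Hc => e e0; apply: contrapT => h2; apply: h1.
    exists e; split => // n; apply: contrapT => h3; apply: h2; exists n => m nm.
    by rewrite ltNge; apply/negP => h4; apply: h3; exists m.
  have /choice[g gP] : forall n, exists m, (n <= m)%N /\ e <= `|tau (A n) - tau (A m)|.
    by move=> n; have [m] := He n; exists m.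
  pose k i := iter i g 0%N.
  have kS i : (k i <= k i.+1)%N by case: (gP (k i)).
  have kle i j : (i <= j)%N -> (k i <= k j)%N.
    elim: j => [|j IH]; first by rewrite leqn0 => /eqP ->.
    by rewrite leq_eqVlt => /orP[/eqP->//|] /IH h1; exact: leq_trans h1 (kS j).
  pose B i := A (k i) `\` A (k i.+1).
  have Bd m n t : (m < n)%N -> B m t -> B n t -> False.
    by move=> mn [_ nt] [tA _]; apply: nt; apply: Ale tA; exact: kle.
  exists e, B; split => //.
  - by move=> n; exact: measurableD.
  - by move=> m n t Bm Bn; case: (ltngtP m n) => // mn;
      [case: (Bd _ _ _ mn Bm Bn)|case: (Bd _ _ _ mn Bn Bm)].
  - by move=> n; rewrite /B tauB//; [case: (gP (k n))|exact: Ale (kS n)].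
exfalso; apply: nA.
have cA : cvgn (tau \o A).
  apply: cauchy_cvg; apply: cauchy_exP => e e0.
  have [n nm] := Hc e e0; exists (tau (A n)), n => // m /= nm'.
  by rewrite -ball_normE /=; exact: nm.
set g := limn (tau \o A) in cA.
have gA : (fun n => `|g - tau (A n)|) @ \oo --> (0 : R).
  rewrite -(normr0 X) -(subrr g); apply: cvg_norm; apply: cvgB => //.
  exact: cvg_cst.
suff g0 : g = 0.
  by move: gA; rewrite g0; under eq_fun do rewrite sub0r normrN.
pose G := L0_fun (bfs_incl X g); pose W n := L0_fun (bfs_incl X (tau (A n))).
have mG : measurable_fun setT G by exact: measurable_L0_fun.
have mW n : measurable_fun setT (W n) by exact: measurable_L0_fun.
have Gg : represents g G by exact: nearW.
have Wt n : represents (tau (A n)) (W n) by exact: nearW.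
have W0 n : {ae mu, forall t, 0 <= W n t}.
  have H : {ae mu, forall t, 0 <= T (localize (A n)) t}%E.
    by apply: ae_operator => t It t0; exact: (operator_ge0 Tpos It t0 (localize_ge0 _)).
  by apply: filterS2 (tauE (mA n)) H => t <-; rewrite lee_fin.
have WW m n : (m <= n)%N -> {ae mu, forall t, W n t <= W m t}.
  move=> mn; have H : {ae mu, forall t, T (localize (A n)) t <= T (localize (A m)) t}%E.
    apply: ae_operator => t It t0; apply: (operator_le Tpos It t0).
    - exact: measurable_localize.
    - exact: measurable_localize.
    - exact: localize_ge0.
    - exact: localize_ge0.
    apply: nearW => s; rewrite ler_wpM2l// !indicE ler_nat.
    by case: (boolP (s \in A n)) => //; rewrite inE => /(Ale _ _ mn) As; rewrite mem_set.
  by apply: filterS3 (tauE (mA n)) (tauE (mA m)) H => t <- <-; rewrite lee_fin.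
(* The positive part of [|g| - tau (A m)] is at most [|g - tau (A n)|] for [m <= n],
   so its norm is [0]. *)
have GW m : {ae mu, forall t, `|G t| <= W m t}.
  pose u t := Num.max 0 (`|G t| - W m t).
  have mu_ : measurable_fun setT u.
    apply: measurable_maxr; first exact: measurable_cst.
    by apply: measurable_funB (mW m); exact: measurableT_comp.
  have u0 t : `|u t| = u t by rewrite ger0_norm// le_max lexx.
  have ule n : (m <= n)%N -> {ae mu, forall t, `|u t| <= `|G t - W n t|}.
    move=> mn; apply: filterS2 (W0 n) (WW _ _ mn) => t w0 w1.
    rewrite u0 /u ge_max normr_ge0/= lerBlDr.
    rewrite -[X in `|X|](subrK (W n t)) (le_trans (ler_normD _ _))// lerD2l.
    by rewrite ger0_norm.
  have uG n := represents_sub Gg (Wt n).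
  have [x xu _] := represents_ideal mu_ (uG m) (ule m (leqnn m)).
  have x0 : x = 0.
    apply/eqP; rewrite -normr_le0; apply: (cvgr_to_ge gA).
    exists m => // n /= mn; exact: represents_le xu (uG n) (ule n mn).
  apply: filterS2 xu (represents0 X) => t; rewrite x0 => -> /eqP.
  by rewrite eq_maxl subr_le0.
have Tfin : {ae mu, forall t, (T h t < +oo)%E}.
  have -> : h = localize setT.
    by apply/funext => t; rewrite /localize indicE in_setT mulr1.
  by apply: filterS (tauE measurableT) => t <-; exact: ltry.
have W_cvg0 : {ae mu, forall t, (fun n => W n t) @ \oo --> (0 : R)}.
  have H : {ae mu, forall t, (T h t < +oo)%E ->
      (fun n => T (localize (A n)) t) @ \oo --> 0%E}.
    by apply: ae_operator => t It t0; exact: (operator_cvg0 Tpos It t0).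
  apply: filterS3 Tfin H (ae_foralln (fun n => tauE (mA n))) => t fin /(_ fin) + Wn.
  by under eq_fun do rewrite -Wn; move=> /fine_cvg.
apply: (represents_inj Gg).
apply: represents_ae (represents0 X) _.
apply: filterS2 W_cvg0 (ae_foralln GW) => t Wc GWt.
by apply/esym/eqP; rewrite -normr_le0; apply: (cvgr_to_ge Wc); exact: nearW.
Qed.

End Localization.
End OptimalDomain.

(** * Bounded sequences inside the optimal domain *)

Section LinftyInOptimalDomain.
Context {R : realType} (I : interval R) (X : banachFunctionSpace I).
Hypothesis HI : I = `[0, 1]%R \/ I = `[0, +oo[%R.
Variable (T : (@lebR R -> R) -> @lebR R -> \bar R).
Hypothesis Tpos : positive_integral_operator I T.
Hypothesis Tbnd : bounded_on T X.
Local Notation mu := (leb_on I).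
Variables (h : @lebR R -> R) (yh : X).
Hypothesis mh : measurable_fun setT h.
Hypothesis h0 : forall t, 0 <= h t.
Hypothesis yhE : represents yh h.
Variable B : nat -> set (@lebR R).
Hypothesis mB : forall n, measurable (B n).
Hypothesis Bdisj : forall m n t, B m t -> B n t -> m = n.
Implicit Types (t s : nat -> R).

(** [sum_k t k h chi_(B k)], written pointwise through the label of the set that
    contains the point. *)
Definition glue t : @lebR R -> R :=
  fun x => h x * (t (xget 0%N [set k | B k x]) * \1_(\bigcup_k B k) x).

Lemma glueE t k x : B k x -> glue t x = t k * h x.
Proof.
move=> Bk; rewrite /glue indicE mem_set; last by exists k.
rewrite mulr1 mulrC; congr (t _ * _).
by case: xgetP => [j _ /= Bj|/(_ k)//]; exact: Bdisj Bj Bk.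
Qed.

Lemma glue_out t x : ~ (\bigcup_k B k) x -> glue t x = 0.
Proof. by move=> nB; rewrite /glue indicE memNset// !mulr0. Qed.

Lemma measurable_glue t : measurable_fun setT (glue t).
Proof.
have mU : measurable (\bigcup_k B k) by exact: bigcup_measurable.
rewrite -(setUv (\bigcup_k B k)); apply/measurable_funU => //.
  exact: measurableC.
split.
  apply/measurable_fun_bigcup => // k.
  apply: (eq_measurable_fun (fun x => t k * h x)).
    by move=> x; rewrite inE => /glueE ->.
  by apply: measurable_funM; [exact: measurable_cst|exact: measurable_funTS].
apply: (eq_measurable_fun (fun=> 0 : R)); last exact: measurable_cst.
by move=> x; rewrite inE => /glue_out ->.
Qed.

Lemma glue_le t c x : bounded_by t c -> `|glue t x| <= c * h x.
Proof.
move=> tc; have c0 : 0 <= c := le_trans (normr_ge0 _) (tc 0%N).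
have [[k _ Bk]|nB] := pselect ((\bigcup_k B k) x).
  by rewrite (glueE _ Bk) normrM (ger0_norm (h0 x)) ler_wpM2r.
by rewrite glue_out// normr0 mulr_ge0.
Qed.

Lemma glue_ge t k x : `|t k| * localize h (B k) x <= `|glue t x|.
Proof.
have [Bk|nB] := pselect (B k x).
  by rewrite (glueE _ Bk) normrM (ger0_norm (h0 x)) /localize indicE mem_set// mulr1.
by rewrite /localize indicE memNset// !mulr0.
Qed.

Lemma glue_linear a t s x : glue (fun i => a * t i + s i) x = a * glue t x + glue s x.
Proof. by rewrite /glue; ring. Qed.

Definition glue_class t : L0_on I :=
  L0_class mu (mfun_Sub (mem_set (measurable_glue t))).

Lemma glue_classE t : {ae mu, forall x, L0_fun (glue_class t) x = glue t x}.
Proof. exact: L0_classK. Qed.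

Lemma glue_class_linear a t s :
  glue_class (fun i => a * t i + s i) = a *: glue_class t + glue_class s.
Proof.
apply: L0_eqP; have := L0_addE (a *: glue_class t) (glue_class s).
have := L0_scaleE a (glue_class t) => h1 h2.
apply: filterS3 (filterI h1 h2) (glue_classE (fun i => a * t i + s i))
  (filterI (glue_classE t) (glue_classE s)) => x [e1 e2] -> [e3 e4].
by rewrite glue_linear -e3 -e4; apply/esym; exact: etrans e2 (congr1 (+%R^~ _) e1).
Qed.

Variable tau : set (@lebR R) -> X.
Hypothesis tauE : forall A, measurable A -> image_class T (localize h A) (tau A).

Lemma glue_TX t c : bounded_by t c ->
  [/\ TX T X (glue_class t), TX_norm T X (glue_class t) <= c * `|tau setT| &
      forall k, `|t k| * `|tau (B k)| <= TX_norm T X (glue_class t)].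
Proof.
move=> tc; have c0 : 0 <= c := le_trans (normr_ge0 _) (tc 0%N).
have mg : measurable_fun setT (fun x => `|glue t x|).
  apply: (measurableT_comp (@normr_measurable R setT)); exact: measurable_glue.
have hE : localize h setT = h.
  by apply/funext => x; rewrite /localize indicE in_setT mulr1.
have mL A (mA : measurable A) := measurable_localize mh mA.
have mZ a A (mA : measurable A) : measurable_fun setT (fun x => a * localize h A x).
  by apply: measurable_funM; [exact: measurable_cst|exact: mL].
have [y yg _] : exists2 y : X, represents y (fun x => `|glue t x|) & `|y| <= `|c *: yh + 0|.
  apply: (represents_ideal mg (represents_linear c yhE (represents0 X))).
  apply: nearW => x; rewrite addr0 normr_id (le_trans (glue_le x tc))//.
  exact: ler_norm.
have [z zg] := image_class_exists HI Tpos Tbnd mg yg.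
have zabs : image_class T (fun x => `|L0_fun (glue_class t) x|) z.
  apply: (image_class_ae HI Tpos mg) zg.
    by apply: (measurableT_comp (@normr_measurable R setT)); exact: measurable_L0_fun.
  by apply: filterS (glue_classE t) => x ->.
have -> : TX_norm T X (glue_class t) = `|z|.
  rewrite /TX_norm; congr `|_|; case: xgetP => [x _ xz|/(_ z)]; last by case.
  exact: image_class_inj xz zabs.
split; first by exists z.
- rewrite -(ger0_norm c0) -normrZ.
  have H := image_classZ HI Tpos (mL _ measurableT) c0 (localize_ge0 h0 setT)
    (tauE measurableT).
  apply: (image_class_le HI Tpos mg (mZ c _ measurableT) _ _ _ zg H).
  + by move=> x; exact: normr_ge0.
  + by move=> x; apply: mulr_ge0 => //; exact: localize_ge0.
  + by apply: nearW => x; rewrite hE; exact: glue_le.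
- move=> k; rewrite -(normr_id (t k)) -normrZ.
  have H := image_classZ HI Tpos (mL _ (mB k)) (normr_ge0 (t k))
    (localize_ge0 h0 (B k)) (tauE (mB k)).
  apply: (image_class_le HI Tpos (mZ _ _ (mB k)) mg _ _ _ H zg).
  + by move=> x; apply: mulr_ge0 => //; exact: localize_ge0.
  + by move=> x; exact: normr_ge0.
  + by apply: nearW => x; exact: glue_ge.
Qed.

(** The embedding is [glue], transported to [E]; by [glue_TX], and up to the
    constants of the renorming, it is bounded above by [|tau setT|] and below by
    the lower bound [e] of the [|tau (B n)|]. *)
Lemma optimal_domain_linfty_copy (E : TX_renorming T X) (e : R) :
  0 < e -> (forall n, e <= `|tau (B n)|) ->
  exists J al be, @linfty_copy R E J al be.
Proof.
move=> e0 He; have [a [b [a0 b0 ab]]] := rn_equiv E.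
pose J t : E := xget 0 [set x | rn_incl E x = glue_class t].
have JE t c : bounded_by t c -> rn_incl E (J t) = glue_class t.
  move=> /glue_TX[+ _ _]; rewrite -(rn_range E) => -[x _ xt].
  by rewrite /J; case: xgetP => [y _ //|/(_ x)/(_ xt)].
exists J, (a * e), (b * `|tau setT|); split.
- exact: mulr_gt0.
- move=> c t s d td sd; apply: (@rn_incl_inj _ _ _ _ E).
  rewrite linearP (JE _ _ td) (JE _ _ sd) -glue_class_linear.
  apply: (JE _ (`|c| * d + d)) => i; rewrite (le_trans (ler_normD _ _))// lerD//.
  by rewrite normrM ler_wpM2l.
- move=> t c tc; have /andP[_] := ab (J t); rewrite (JE _ _ tc) => /le_trans; apply.
  have [_ H _] := glue_TX tc; rewrite -mulrA ler_wpM2l ?(ltW b0)//.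
  by rewrite mulrC.
- move=> t c i tc; have /andP[+ _] := ab (J t); rewrite (JE _ _ tc).
  apply: le_trans; have [_ _ H] := glue_TX tc; rewrite -mulrA ler_wpM2l ?(ltW a0)//.
  by apply: le_trans (H i); rewrite mulrC ler_wpM2l.
Qed.

End LinftyInOptimalDomain.

(** * Decreasing rearrangements *)

Section Rearrangement.
Context {R : realType} (I : interval R).
Hypothesis HI : I = `[0, 1]%R \/ I = `[0, +oo[%R.
Local Notation mu := (leb_on I).
Implicit Types (u v : @lebR R -> R) (x y s : R).

Lemma leb_on_unit_itv (A : set (@lebR R)) : I = `[0, 1] -> measurable A ->
  (mu A <= 1)%E.
Proof.
move=> IE mA; apply: (@le_trans _ _ (leb ([set` `[0, 1]] : set (@lebR R)))).
  rewrite /leb_on /= /mrestr; apply: le_measure.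
  - by rewrite inE; apply: measurableI; [exact: mA|exact: measurable_lebR_itv].
  - by rewrite inE; exact: measurable_lebR_itv.
  - by move=> z [_]; rewrite IE.
by rewrite leb_itv /= lte_fin ltr01 sube0.
Qed.

Definition distribution u s : \bar R := mu [set t | s < `|u t|].

(** The generalized inverse of the distribution function; the value [0] on the
    negative half-line makes its superlevel sets intervals. *)
Definition rearrangement u : @lebR R -> R := fun x : R =>
  if 0 < x then sup [set s | 0 <= s /\ (x%:E < distribution u s)%E] else 0.

Definition finite_distribution u := forall s, 0 < s -> (distribution u s < +oo)%E.

Lemma distribution_le u v s : measurable_fun setT u -> measurable_fun setT v ->
  {ae mu, forall t, `|u t| <= `|v t|} -> (distribution u s <= distribution v s)%E.
Proof.
move=> mu_ mv uv; apply: leb_on_ae_le; [exact: measurable_gt|exact: measurable_gt|].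
by apply: filterS uv => t uv /= /lt_le_trans; exact.
Qed.

Lemma distribution_nonincreasing u s s' : measurable_fun setT u -> s <= s' ->
  (distribution u s' <= distribution u s)%E.
Proof.
move=> mu_ ss; apply: leb_on_ae_le; [exact: measurable_gt|exact: measurable_gt|].
by apply: nearW => t /=; exact: le_lt_trans.
Qed.

Lemma distribution_small u x : measurable_fun setT u -> finite_distribution u ->
  0 < x -> exists2 s, 0 < s & (distribution u s < x%:E)%E.
Proof.
move=> mu_ fu x0.
pose F n : set (@lebR R) := [set t | n.+1%:R < `|u t|].
have F0 : \bigcap_n F n = set0.
  rewrite -subset0 => t Ft.
  have := archi_boundP (normr_ge0 (u t)); set n := Num.bound _ => un.
  have : F n t by exact: Ft.
  rewrite /F/= => /lt_trans/(_ un); rewrite ltr_nat; lia.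
have mF n : measurable (F n) by exact: measurable_gt.
have cF : (mu \o F) n @[n --> \oo] --> 0%E.
  rewrite -(measure0 mu) -F0; apply: nonincreasing_cvg_mu.
  - exact: (fu _ (ltr0n _ 1)).
  - exact: mF.
  - by rewrite F0; exact: measurable0.
  - move=> m n mn; apply/subsetPset => t /=; apply: le_lt_trans.
    by rewrite ler_nat.
apply: contrapT => h; have : (x%:E <= lim ((mu \o F) n @[n --> \oo]))%E.
  apply: lime_ge; first by apply/cvg_ex; exists 0%E.
  apply: nearW => n /=; rewrite leNgt; apply/negP => Fx.
  by apply: h; exists n.+1%:R.
by rewrite (cvg_lim _ cF)// lee_fin leNgt x0.
Qed.

Lemma distribution_right_continuous u x s : measurable_fun setT u ->
  (x%:E < distribution u s)%E ->
  exists2 s', s < s' & (x%:E < distribution u s')%E.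
Proof.
move=> mu_ xs.
pose F n : set (@lebR R) := [set t | s + n.+1%:R^-1 < `|u t|].
have mF n : measurable (F n) by exact: measurable_gt.
have UF : \bigcup_n F n = [set t | s < `|u t|].
  apply/seteqP; split => [t [n _]|t /= sut].
    by rewrite /F/=; apply: lt_trans; rewrite ltrDl invr_gt0.
  have [n ns] := ltr_add_invr sut; exists n => //.
have cF : (mu \o F) n @[n --> \oo] --> mu (\bigcup_n F n).
  apply: nondecreasing_cvg_mu.
  - exact: mF.
  - by apply: bigcupT_measurable; exact: mF.
  - move=> m n mn; apply/subsetPset => t /=; apply: le_lt_trans.
    by rewrite lerD2l lef_pV2 ?posrE ?ltr0n// ler_nat.
apply: contrapT => h; have : (lim ((mu \o F) n @[n --> \oo]) <= x%:E)%E.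
  apply: lime_le; first by apply/cvg_ex; exists (mu (\bigcup_n F n)).
  apply: nearW => n /=; rewrite leNgt; apply/negP => Fx.
  by apply: h; exists (s + n.+1%:R^-1) => //; rewrite ltrDl invr_gt0.
by rewrite (cvg_lim _ cF)// UF leNgt xs.
Qed.

Lemma rearrangement_neg u x : x <= 0 -> rearrangement u x = 0.
Proof. by move=> x0; rewrite /rearrangement ltNge x0. Qed.

Section FiniteDistribution.
Variable u : @lebR R -> R.
Hypotheses (mu_ : measurable_fun setT u) (fu : finite_distribution u).

(** By right continuity of the distribution function, the superlevel set of the
    rearrangement at height [s] is exactly the interval from [0] to
    [distribution u s]; all its properties follow. *)
Lemma rearrangement_gt x s : 0 < x -> 0 <= s ->
  (s < rearrangement u x) = (x%:E < distribution u s)%E.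
Proof.
move=> x0 s0; rewrite /rearrangement x0.
set S := [set s | _].
have ubS : has_ubound S.
  have [s' s'0 s'x] := distribution_small mu_ fu x0; exists s' => r [r0 rx].
  rewrite leNgt; apply/negP => /ltW/(distribution_nonincreasing mu_).
  by move=> /le_lt_trans/(_ s'x)/(lt_trans rx); rewrite ltxx.
apply/idP/idP => [sS|xs].
  have [r [r0 rx] sr] : exists2 r, S r & s < r.
    apply: contrapT => h; move: sS; apply/negP; rewrite -leNgt.
    have [->|/set0P[r Sr]] := eqVneq S set0; first by rewrite sup0.
    apply: ge_sup; first by exists r.
    by move=> r' Sr'; rewrite leNgt; apply/negP => sr'; apply: h; exists r'.
  by apply: lt_le_trans rx _; exact: distribution_nonincreasing (ltW sr).
have [s' ss' xs'] := distribution_right_continuous mu_ xs.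
apply: (lt_le_trans ss'); apply: ub_le_sup => //.
by split; [exact: le_trans s0 (ltW ss')|].
Qed.

Lemma rearrangement_ge0 x : 0 <= rearrangement u x.
Proof.
rewrite /rearrangement; case: ltP => // x0; set S := [set s | _].
have [->|/set0P[r Sr]] := eqVneq S set0; first by rewrite sup0.
have [r0 _] := Sr; apply: le_trans r0 _; apply: ub_le_sup => //.
have [s' s'0 s'x] := distribution_small mu_ fu x0; exists s' => q [q0 qx].
rewrite leNgt; apply/negP => /ltW/(distribution_nonincreasing mu_).
by move=> /le_lt_trans/(_ s'x)/(lt_trans qx); rewrite ltxx.
Qed.

Lemma rearrangement_nonincreasing x y : 0 < x -> x <= y ->
  rearrangement u y <= rearrangement u x.
Proof.
move=> x0 xy; rewrite leNgt; apply/negP.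
rewrite rearrangement_gt ?(lt_le_trans x0)// ?rearrangement_ge0// => yd.
have : (x%:E < distribution u (rearrangement u x))%E by apply: le_lt_trans yd; rewrite lee_fin.
by rewrite -rearrangement_gt ?rearrangement_ge0// ltxx.
Qed.

End FiniteDistribution.

Lemma measurable_nonincreasing_pos (f : @lebR R -> R) :
  (forall x : R, x <= 0 -> f x = 0) -> (forall x, 0 <= f x) ->
  (forall x y : R, 0 < x -> x <= y -> f y <= f x) -> measurable_fun setT f.
Proof.
move=> fneg f0 fni; apply: measurable_fun_lebR.
apply: (measurability _ (RGenOInfty.measurableE R)) => //.
move=> _ [_ [r ->] <-]; rewrite setTI.
have [r0|r0] := ltP r 0.
  rewrite (_ : _ @^-1` _ = setT); first exact: measurableT.
  by apply/seteqP; split => // x _ /=; rewrite in_itv/= andbT (lt_le_trans r0).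
apply: is_interval_measurable => x y /=; rewrite !in_itv/= !andbT => rx ry z /andP[xz zy].
have x0 : 0 < x.
  by rewrite ltNge; apply/negP => x0; move: rx; rewrite fneg// ltNge r0.
rewrite in_itv/= andbT (lt_le_trans ry)// fni//; exact: lt_le_trans xz.
Qed.

Lemma measurable_rearrangement u : measurable_fun setT u -> finite_distribution u ->
  measurable_fun setT (rearrangement u).
Proof.
move=> mu_ fu; apply: measurable_nonincreasing_pos.
- by move=> x; exact: rearrangement_neg.
- by move=> x; exact: rearrangement_ge0.
- by move=> x y; exact: rearrangement_nonincreasing.
Qed.

Lemma rearrangement_equimeasurable u s : measurable_fun setT u ->
  finite_distribution u -> 0 < s ->
  mu [set t | s < `|rearrangement u t|] = mu [set t | s < `|u t|].
Proof.
move=> mu_ fu s0; rewrite -[RHS]/(distribution u s).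
have d0 : (0 <= distribution u s)%E by exact: measure_ge0.
have [r rE] : exists r, distribution u s = r%:E.
  by exists (fine (distribution u s)); rewrite fineK// ge0_fin_numE// fu.
have r0 : 0 <= r by move: d0; rewrite rE lee_fin.
have rI : forall t : R, 0 < t < r -> [set` I] t.
  move=> t /andP[t0 tr]; case: HI => IE; rewrite {1}IE /= in_itv/= ?andbT ltW//=.
  rewrite (le_trans (ltW tr))// -lee_fin -rE; apply: leb_on_unit_itv => //.
  exact: measurable_gt.
transitivity (leb ([set` `]0, r[] : set (@lebR R))); last first.
  rewrite leb_itv /= lte_fin rE; case: ltP => r0'; first by rewrite oppr0 adde0.
  by congr EFin; apply/eqP; rewrite eq_le r0 r0'.
rewrite -[LHS]/(leb ([set t | s < `|rearrangement u t|] `&` [set` I])).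
congr (leb _); apply/seteqP; split => t /=.
  rewrite ger0_norm ?rearrangement_ge0// => -[st It]; rewrite in_itv/=.
  have t0 : 0 < (t : R).
    rewrite ltNge; apply/negP => t0; move: st.
    by rewrite rearrangement_neg// ltNge (ltW s0).
  by rewrite t0 -lte_fin -rE -rearrangement_gt// ltW.
rewrite in_itv/= => /[dup] /rI It /andP[t0 tr]; split => //.
by rewrite ger0_norm ?rearrangement_ge0// rearrangement_gt// ?rE// ltW.
Qed.

Lemma rearrangement_le u v : measurable_fun setT u -> measurable_fun setT v ->
  finite_distribution u -> finite_distribution v ->
  {ae mu, forall t, `|u t| <= `|v t|} ->
  forall x, 0 < x -> rearrangement u x <= rearrangement v x.
Proof.
move=> mu_ mv fu fv uv x x0; rewrite leNgt; apply/negP.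
rewrite rearrangement_gt ?rearrangement_ge0// => xd.
have := lt_le_trans xd (distribution_le (rearrangement v x) mu_ mv uv).
by rewrite -rearrangement_gt ?rearrangement_ge0// ltxx.
Qed.

End Rearrangement.

(** * A slowly varying majorant of the rearrangement *)

Section Majorant.
Context {R : realType} (I : interval R).
Hypothesis HI : I = `[0, 1]%R \/ I = `[0, +oo[%R.
Local Notation mu := (leb_on I).
Implicit Types (u v : @lebR R -> R) (x y s : R).

Lemma ae_pick (P : @lebR R -> Prop) (a : R) : 0 < a -> {ae mu, forall t, P t} ->
  exists x, [/\ 0 < x, x < a, [set` I] x & P x].
Proof.
move=> a0 [N [mN N0 PN]]; apply: contrapT => h.
pose b := Num.min a 1.
have b0 : 0 < b by rewrite lt_min a0 ltr01.
have bN : [set` `]0, b[] `<=` N `&` [set` I].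
  move=> t /=; rewrite in_itv/= lt_min => /and3P[t0 ta t1].
  have It : [set` I] t by case: HI => -> /=; rewrite in_itv/= ltW//= ltW.
  by split => //; apply: PN => Pt; apply: h; exists t.
have : (leb ([set` `]0%R, b[] : set (@lebR R)) <= 0)%E.
  have <- : leb (N `&` [set` I]) = 0%E by exact: N0.
  apply: le_measure.
  - by rewrite inE; exact: measurable_lebR_itv.
  - by rewrite inE; apply: measurableI; [exact: mN|exact: measurable_lebR_itv].
  - exact: bN.
by rewrite leb_itv /= lte_fin b0 oppr0 adde0 lee_fin leNgt b0.
Qed.

Lemma integral_ge_itv (D : set (@lebR R)) (f : @lebR R -> R) (a b c : R) :
  measurable D -> measurable_fun D f -> (forall t, D t -> 0 <= f t) -> a <= b ->
  0 <= c -> (forall t : R, a < t <= b -> D t /\ c <= f t) ->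
  ((c * (b - a))%:E <= \int[leb]_(t in D) (f t)%:E)%E.
Proof.
move=> mD mf f0 ab c0 H.
have mab : measurable ([set` `]a, b]] : set (@lebR R)) by exact: measurable_lebR_itv.
have abD : [set` `]a, b]] `<=` D by move=> t /=; rewrite in_itv/= => /H[].
apply: (@le_trans _ _ (\int[leb]_(t in [set` `]a, b]]) (f t)%:E)%E); last first.
  apply: (ge0_subset_integral _ mab mD _ _ abD); first by apply/measurable_EFinP.
  by move=> t Dt; rewrite lee_fin f0.
have -> : ((c * (b - a))%:E = \int[leb]_(t in ([set` `]a, b]] : set (@lebR R))) (cst c%:E t))%E.
  rewrite integral_cst// leb_itv /= lte_fin EFinM; case: ltP => // ba.
  by rewrite (_ : b = a) ?subrr//; apply/eqP; rewrite eq_le ab ba.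
apply: (ge0_le_integral _ mab).
- by move=> t _; rewrite lee_fin.
- exact: measurable_cst.
- by apply/measurable_EFinP; exact: measurable_funS mf.
- by move=> t /=; rewrite in_itv/= lee_fin => /H[].
Qed.

Lemma measurable_div_id (D : set (@lebR R)) (f : @lebR R -> R) x : 0 < x ->
  D `<=` `[x, +oo[%classic -> measurable_fun setT f ->
  measurable_fun D (fun t : @lebR R => f t / (t : R)).
Proof.
move=> x0 Dx mf.
apply: (eq_measurable_fun (fun t : @lebR R => f t * (Num.max x (t : R))^-1)).
  by move=> t; rewrite inE => /Dx /=; rewrite in_itv/= andbT => xt; rewrite max_r.
apply: measurable_funTS; apply: (measurable_funM mf).
apply: measurable_fun_lebR; apply: nonincreasing_measurable => // s t st.
by rewrite lef_pV2 ?posrE ?lt_max ?x0// ge_max !le_max lexx/= st orbT.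
Qed.

Lemma copson_cst_infty s x : I = `[0, +oo[ -> 0 < s -> 0 < x ->
  copson_op I (cst s) x = +oo%E.
Proof.
move=> IE s0; pose D x := [set` I] `&` `[x, +oo[%classic : set (@lebR R).
have mD r : measurable (D r) by apply: measurableI; exact: measurable_lebR_itv.
have DI (r t : R) : 0 < r -> D r t <-> r <= t.
  move=> r0; rewrite /D IE /= !in_itv/= !andbT; split => [[]//|rt].
  by split => //; exact: le_trans (ltW r0) rt.
clear IE; have mst (r : R) A : 0 < r -> A `<=` D r ->
    measurable_fun A (fun t : @lebR R => s / (t : R)).
  move=> r0 AD; apply: (measurable_div_id r0 _ (measurable_cst s)).
  by move=> t /AD[].
have st0 (r t : R) : 0 < r -> D r t -> 0 <= s / t.
  by move=> r0 /(DI _ _ r0) rt; rewrite divr_ge0 ?(ltW s0)// (le_trans (ltW r0)).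
(* The part of the half-line from [r] to [2 r] contributes at least [s / 3],
   whatever [r] is. *)
have step n : forall r : R, 0 < r -> ((n%:R * (s / 3))%:E <= copson_op I (cst s) r)%E.
  elim: n => [|n IH] r r0.
    by rewrite mul0r; apply: integral_ge0 => t Dt; rewrite lee_fin; exact: st0 r0 Dt.
  have r20 : 0 < 2 * r by lra.
  pose A : set (@lebR R) := [set` `[r, 2 * r[].
  have mA : measurable A by exact: measurable_lebR_itv.
  have AD : A `<=` D r by move=> t; rewrite /A /= in_itv/= => /andP[rt _]; apply/DI.
  have DE : D r = A `|` D (2 * r).
    apply/seteqP; split => t.
      move=> /(DI _ _ r0) rt; have [t2|t2] := ltP (t : R) (2 * r).
        by left; rewrite /A/= in_itv/= rt.
      by right; apply/DI.
    case=> [/AD//|/(DI _ _ r20) t2]; apply/DI => //; lra.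
  rewrite /copson_op -/(D r) DE (ge0_integral_setU _ mA (mD _)).
  - rewrite -natr1 mulrDl mul1r addrC EFinD; apply: leeD (IH _ r20).
    have -> : s / 3 = s / (3 / 2 * r) * (3 / 2 * r - r) by field; lra.
    apply: (integral_ge_itv mA).
    + exact: mst r0 AD.
    + by move=> t /AD; exact: st0.
    + lra.
    + by rewrite divr_ge0 ?(ltW s0)//; lra.
    + move=> t /andP[rt tr]; split.
        by rewrite /A /= in_itv/=; apply/andP; split; lra.
      by rewrite /= ler_pM2l// lef_pV2 ?posrE; lra.
  - by apply/measurable_EFinP; rewrite -DE; apply: mst r0 _.
  - by move=> t; rewrite -DE lee_fin; exact: st0.
  - apply/disj_setPS => t []; rewrite /A /= in_itv/= => /andP[_ tr] /(DI _ _ r20).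
    by rewrite leNgt tr.
move=> x0; case E: (copson_op I (cst s) x) => [r|//|].
  have r0 : 0 <= r / (s / 3).
    by have := step 0%N x x0; rewrite E lee_fin mul0r => r0; rewrite !divr_ge0// ltW.
  have := step (Num.bound (r / (s / 3))) x x0.
  by rewrite E lee_fin -ler_pdivlMr ?divr_gt0// leNgt (archi_boundP r0).
by have := step 0%N x x0; rewrite E.
Qed.

Variable X : banachFunctionSpace I.
Hypothesis symX : symmetric_space X.
Hypothesis cesX : bounded_on cesaro_op X.
Hypothesis copX : bounded_on (copson_op I) X.

(** Otherwise [X] would contain a function equimeasurable with a nonzero constant,
    hence that constant, whose image under the Copson operator is infinite. *)
Lemma element_finite_distribution (y : X) u : measurable_fun setT u ->
  represents y u -> finite_distribution I u.
Proof.
move=> mu_ yu s s0; case: (HI) => IE.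
  apply: le_lt_trans (leb_on_unit_itv IE _) (ltry _); exact: measurable_gt.
rewrite ltey; apply/eqP => doo.
pose v : @lebR R -> R := fun t => s * \1_[set t | s < `|u t|] t.
have mset : measurable [set t | s < `|u t|] by exact: measurable_gt.
have mv : measurable_fun setT v.
  by apply: measurable_funM; [exact: measurable_cst|exact: measurable_indic].
have [|z zv _] := represents_ideal mv yu.
  apply: nearW => t; rewrite /v indicE; case: (boolP (_ \in _)) => [|_].
    by rewrite inE /= mulr1 (gtr0_norm s0) => /ltW.
  by rewrite mulr0 normr0.
have [||x xs _] := represents_symmetric (u := cst s) symX _ mv zv.
- exact: measurable_cst.
- move=> r r0; have [rs|sr] := ltP r s.
    have -> : [set t | r < `|v t|] = [set t | s < `|u t|].
      apply/seteqP; split => t /=; rewrite /v indicE.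
        case: (boolP (_ \in _)) => [|_]; first by rewrite inE.
        by rewrite mulr0 normr0 ltNge (ltW r0).
      by move=> su; rewrite mem_set// mulr1 gtr0_norm.
    rewrite [RHS]doo; apply/eqP; rewrite -leye_eq -doo; apply: leb_on_ae_le => //.
      by apply: measurable_gt; exact: measurable_cst.
    by apply: nearW => t _ /=; rewrite gtr0_norm.
  have E0 : [set t : @lebR R | r < `|cst s t|] = set0.
    by apply/seteqP; split => t //=; rewrite gtr0_norm// ltNge sr.
  rewrite E0; congr (mu _); apply/seteqP; split => t //=; rewrite /v indicE.
  by case: (_ \in _); rewrite ?mulr1 ?mulr0 ?normr0 ?gtr0_norm// ltNge ?sr// (ltW r0).
have [z' z'E] := image_class_exists HI (copson_positive HI) copX (measurable_cst _) xs.
have [t [t0 _ _]] := ae_pick ltr01 z'E.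
by rewrite copson_cst_infty.
Qed.

(** The majorant is [F x = sup_(0 < t <= 1) t u*(t x)].  Each [t u*(t x)] is at most
    [C u* x], because [u*] is at least [u*(t x)] up to [t x]; so [F] is in [X].
    Replacing [t] by [t / 2] shows [F x <= 2 F (2 x)], which makes dilations
    superfluous. *)
Lemma exists_doubling_majorant (y : X) u : measurable_fun setT u -> represents y u ->
  ~ {ae mu, forall t, u t = 0} ->
  exists (F : @lebR R -> R) (yF : X),
  [/\ measurable_fun setT F /\ represents yF F,
      (forall t, 0 <= F t) /\ (forall x, 0 < x -> 0 < F x),
      forall x y, 0 < x -> x <= y -> F y <= F x,
      forall x, 0 < x -> F x <= 2 * F (2 * x) &
      forall x, 0 < x -> rearrangement I u x <= F x].
Proof.
move=> mu_ yu un0.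
have fu := element_finite_distribution mu_ yu.
set w := rearrangement I u.
have mw : measurable_fun setT w by exact: measurable_rearrangement.
have w0 t : 0 <= w t by exact: rearrangement_ge0.
have wni x' y' : 0 < x' -> x' <= y' -> w y' <= w x'.
  by exact: rearrangement_nonincreasing.
have [yw ywE _] := represents_symmetric symX mw mu_ yu
  (fun s => @rearrangement_equimeasurable _ _ HI u s mu_ fu).
have [z zE] := image_class_exists HI (cesaro_positive HI) cesX mw ywE.
have Cw t x : 0 < t <= 1 -> 0 < x -> ((t * w (t * x))%:E <= cesaro_op w x)%E.
  move=> /andP[t0 t1] x0; have tx0 : 0 < t * x by rewrite mulr_gt0.
  rewrite /cesaro_op.
  have H : ((w (t * x)%R * (t * x - 0))%:E <= \int[leb]_(r in [set` `[0%R, x]]) (w r)%:E)%E.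
    apply: integral_ge_itv.
    - exact: measurable_lebR_itv.
    - exact: measurable_funTS.
    - by [].
    - exact: ltW.
    - exact: w0.
    - move=> r /andP[r0 rt]; split; last exact: wni.
      rewrite /= in_itv/= (ltW r0)/= (le_trans rt)// ler_piMl// ltW//.
  have -> : t * w (t * x) = x^-1 * (w (t * x) * (t * x - 0)) by field; rewrite gt_eqF.
  by rewrite EFinM lee_wpmul2l// lee_fin invr_ge0 ltW.
pose S (x : R) := [set r | exists t, 0 < t <= 1 /\ r = t * w (t * x)].
pose F : @lebR R -> R := fun x : R => if 0 < x then sup (S x) else 0.
have FE x : 0 < x -> F x = sup (S x) by move=> x0; rewrite /F x0.
(* [C u*] is finite at some [x' < x], and its value there bounds the supremum at
   [x] since [u*] is nonincreasing. *)
have Sub x : 0 < x -> has_ubound (S x).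
  move=> x0; have [x' [x'0 x'x _ x'E]] := ae_pick x0 zE.
  exists (L0_fun (bfs_incl X z) x') => _ [t [/[dup] /andP[t0 t1] t01 ->]].
  rewrite -lee_fin x'E; apply: le_trans (Cw _ _ t01 x'0).
  rewrite lee_fin ler_wpM2l ?(ltW t0)//; apply: wni; first exact: mulr_gt0.
  by rewrite ler_wpM2l ?ltW.
have Sn0 x : S x !=set0 by exists (1 * w (1 * x)), 1; rewrite ltr01 lexx.
have Fge t x : 0 < t <= 1 -> 0 < x -> t * w (t * x) <= F x.
  by move=> t01 x0; rewrite FE//; apply: ub_le_sup; [exact: Sub|exists t].
have Fle x c : 0 < x -> (forall t, 0 < t <= 1 -> t * w (t * x) <= c) -> F x <= c.
  by move=> x0 H; rewrite FE//; apply: ge_sup => // _ [t [t01 ->]]; exact: H.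
have wF x : 0 < x -> w x <= F x.
  by move=> x0; have := @Fge 1 x; rewrite !mul1r ltr01 lexx; exact.
have F0 x : 0 <= F x.
  rewrite /F; case: ifP => // x0; rewrite -FE//; exact: le_trans (w0 x) (wF _ x0).
have Fni x y' : 0 < x -> x <= y' -> F y' <= F x.
  move=> x0 xy; apply: Fle => [|t /[dup] /andP[t0 t1] t01]; first exact: lt_le_trans xy.
  apply: le_trans (Fge _ _ t01 x0); rewrite ler_wpM2l ?(ltW t0)//.
  by apply: wni; [exact: mulr_gt0|rewrite ler_wpM2l ?(ltW t0)].
have mF : measurable_fun setT F.
  apply: measurable_nonincreasing_pos => //.
  by move=> x x0; rewrite /F ltNge x0.
have [yF yFE _] : exists2 yF : X, represents yF F & `|yF| <= `|z|.
  apply: (represents_ideal (v := L0_fun (bfs_incl X z)) mF); first exact: nearW.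
  apply: filterS2 (ae_pos HI) zE => t [It t0] tE.
  rewrite (ger0_norm (F0 t)); apply: le_trans (ler_norm _).
  by apply: Fle => // r r01; rewrite -lee_fin tE; exact: Cw.
have [x1 [x10 wx1]] : exists x1, 0 < x1 /\ 0 < w x1.
  apply: contrapT => h; apply: un0; exists [set t | 0 < `|u t|]; split.
  - exact: measurable_gt.
  - apply/eqP; rewrite eq_le measure_ge0 andbT leNgt; apply/negP => d0.
    apply: h; have [x1 x10 x1d] : exists2 x1, 0 < x1 & (x1%:E < distribution I u 0)%E.
      rewrite /distribution; case: (mu _) d0 => [r| |//]; last first.
        by exists 1; rewrite ?ltr01 ?ltry.
      rewrite lte_fin => r0; exists (r / 2); first by lra.
      by rewrite lte_fin; lra.
    by exists x1; split => //; rewrite /w rearrangement_gt.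
  - by move=> t /= ut; rewrite normr_gt0; apply/eqP.
exists F, yF; split => //.
- split => // x x0.
  have [xx|xx] := leP x x1; first by rewrite (lt_le_trans wx1)// (le_trans (wni _ _ x0 xx)) ?wF.
  have t01 : 0 < x1 / x <= 1 by rewrite divr_gt0//= ler_pdivrMr// mul1r ltW.
  have := Fge _ _ t01 x0; rewrite divfK ?gt_eqF//; apply: lt_le_trans.
  by rewrite mulr_gt0// divr_gt0.
- move=> x x0; apply: Fle => // t /andP[t0 t1].
  have t01 : 0 < t / 2 <= 1 by apply/andP; split; lra.
  have x20 : 0 < 2 * x by lra.
  have := Fge _ _ t01 x20; rewrite (_ : t / 2 * (2 * x) = t * x); last by field.
  lra.
Qed.

End Majorant.

(** * The operators near the ends of the interval *)

Section Ends.
Context {R : realType} (I : interval R).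
Hypothesis HI : I = `[0, 1]%R \/ I = `[0, +oo[%R.
Local Notation mu := (leb_on I).
Implicit Types (u : @lebR R -> R) (x : R).

(** Neighbourhoods of [0] and [+oo]; in [[0, 1]] the second one is empty, so that
    both intervals are treated alike. *)
Definition ends (n : nat) : set (@lebR R) :=
  [set` I] `&` (`]0, n.+1%:R^-1[ `|` `]n.+1%:R, +oo[)%classic.

Lemma endsP n x : ends n x <->
  [set` I] x /\ (0 < x < n.+1%:R^-1 \/ n.+1%:R < x).
Proof. by rewrite /ends /= !in_itv/= andbT. Qed.

Lemma measurable_ends n : measurable (ends n).
Proof.
apply: measurableI; first exact: measurable_lebR_itv.
by apply: measurableU; exact: measurable_lebR_itv.
Qed.

Lemma ends_decreasing n : ends n.+1 `<=` ends n.
Proof.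
have n12 : n.+1%:R <= n.+2%:R :> R by rewrite ler_nat.
move=> x /endsP[Ix H]; apply/endsP; split => //; case: H => [/andP[x0 xn]|xn].
  left; rewrite x0 (lt_le_trans xn)// lef_pV2 ?posrE ?ltr0n//.
by right; exact: le_lt_trans xn.
Qed.

Lemma bigcap_ends : \bigcap_n ends n = set0.
Proof.
rewrite -subset0 => x H.
have x0 : 0 < (x : R).
  have /endsP[_ [/andP[]//|]] := H 0%N Logic.I; exact: lt_trans.
have xV : 0 <= (x : R)^-1 by rewrite invr_ge0 ltW.
pose n := (Num.bound (x : R) + Num.bound (x : R)^-1)%N.
have /endsP[_ [/andP[_]|]] := H n Logic.I.
  rewrite ltNge => /negP; apply; rewrite -[leRHS]invrK lef_pV2 ?posrE ?invr_gt0 ?ltr0n//.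
  by rewrite (le_trans (ltW (archi_boundP xV)))// ler_nat; rewrite /n; lia.
rewrite ltNge => /negP; apply.
by rewrite (le_trans (ltW (archi_boundP (ltW x0))))// ler_nat; rewrite /n; lia.
Qed.

Section LowerBound.
Variable F : @lebR R -> R.
Hypotheses (mF : measurable_fun setT F) (F0 : forall t, 0 <= F t).
Hypothesis Fni : forall x y : R, 0 < x -> x <= y -> F y <= F x.
Hypothesis F2 : forall x : R, 0 < x -> F x <= 2 * F (2 * x).

Let mL n : measurable_fun setT (localize F (ends n)).
Proof. by apply: measurable_localize => //; exact: measurable_ends. Qed.

Let ends_half n x (t : R) : ends n.*2.+1 x -> x / 2 < t <= x -> ends n t.
Proof.
move=> /endsP[Ix H] /andP[xt tx]; apply/endsP.
have x0 : 0 < x by case: H => [/andP[]//|]; exact: lt_trans.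
have nn : n.*2.+2%:R = 2 * n.+1%:R :> R by rewrite -natrM; congr _%:R; lia.
have t0 : 0 < t by apply: le_lt_trans xt; rewrite divr_ge0// ltW.
split.
  move: Ix; case: HI => -> /=; rewrite !in_itv/= ?andbT (ltW t0)//=.
  by move=> /andP[_]; exact: le_trans.
have n0 : 0 < n.+1%:R :> R by rewrite ltr0n.
case: H => [/andP[_]|]; rewrite nn => xn.
  left; rewrite t0/=; apply: (le_lt_trans tx); apply: (lt_le_trans xn).
  rewrite lef_pV2 ?posrE ?mulr_gt0//.
  by rewrite ler_peMl ?ltW// ltr1n.
by right; apply: le_lt_trans xt; rewrite ler_pdivlMr// mulrC ltW.
Qed.

Let ends_double n x (t : R) : ends n.*2.+1 x -> x < t <= 2 * x -> ends n t.
Proof.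
move=> /endsP[Ix H] /andP[xt tx]; apply/endsP.
have x0 : 0 < x by case: H => [/andP[]//|]; exact: lt_trans.
have nn : n.*2.+2%:R = 2 * n.+1%:R :> R by rewrite -natrM; congr _%:R; lia.
have n0 : 1 <= n.+1%:R :> R by rewrite ler1n.
have H2 : 0 < t < n.+1%:R^-1 \/ n.+1%:R < t.
  case: H => [/andP[_]|]; rewrite nn => xn.
    left; rewrite (lt_trans x0)//= (le_lt_trans tx)// -ltr_pdivlMl//.
    by rewrite -invfM.
  by right; rewrite (lt_trans _ xt)// (le_lt_trans _ xn)//; lra.
split => //; move: Ix H2; case: HI => -> /=; rewrite !in_itv/= ?andbT; last first.
  by move=> _ _; exact: ltW (lt_trans x0 xt).
move=> /andP[_ x1] [/andP[t0 tn]|nt].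
  by rewrite (ltW t0)/= (le_trans (ltW tn))// invf_le1 ?ltr0n// ler1n.
have : n.*2.+2%:R < x.
  case: H => // /andP[_ xn]; exfalso; move: nt; apply/negP; rewrite -leNgt.
  apply: le_trans tx _; apply: le_trans n0; rewrite -ler_pdivlMl// mulr1.
  by rewrite (le_trans (ltW xn))// nn invfM ler_piMr// ?invr_ge0// invf_le1 ?ltr0n// ler1n.
by rewrite nn => xn; exfalso; move: x1; apply/negP; rewrite -ltNge; lra.
Qed.

(** From [x / 2] to [x], which stays inside [ends n], [F] is at least [F x]. *)
Lemma cesaro_ends_ge n x : ends n.*2.+1 x ->
  ((F x / 4)%:E <= cesaro_op (localize F (ends n)) x)%E.
Proof.
move=> xE; have x0 : 0 < x by case/endsP: xE => _ [/andP[]//|]; exact: lt_trans.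
have H : ((F x * (x - x / 2))%:E <=
    \int[leb]_(t in [set` `[0%R, x]]) (localize F (ends n) t)%:E)%E.
  apply: integral_ge_itv.
  - exact: measurable_lebR_itv.
  - exact: measurable_funTS.
  - by move=> t _; exact: localize_ge0.
  - lra.
  - exact: F0.
  - move=> t xt; have tE := ends_half xE xt; move/andP: xt => [xt tx].
    have t0 : 0 < t by apply: lt_trans xt; rewrite divr_gt0.
    split; first by rewrite /= in_itv/= ltW.
    by rewrite /localize indicE mem_set// mulr1 Fni.
rewrite /cesaro_op; apply: (@le_trans _ _ (x^-1 * (F x * (x - x / 2)))%:E).
  rewrite lee_fin (_ : _ * (F x * _) = F x / 2); last by field; rewrite gt_eqF.
  by have := F0 x; lra.
by rewrite EFinM lee_wpmul2l// lee_fin invr_ge0 ltW.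
Qed.

(** From [x] to [2 x], which stays inside [ends n], [F t / t] is at least
    [F (2 x) / (2 x)]. *)
Lemma copson_ends_ge n x : ends n.*2.+1 x ->
  ((F x / 4)%:E <= copson_op I (localize F (ends n)) x)%E.
Proof.
move=> xE; have x0 : 0 < x by case/endsP: xE => _ [/andP[]//|]; exact: lt_trans.
have x20 : 0 < 2 * x by lra.
apply: (@le_trans _ _ (F (2 * x) / (2 * x) * (2 * x - x))%:E).
  rewrite lee_fin (_ : _ * (2 * x - x) = F (2 * x) / 2); last by field; rewrite gt_eqF.
  by have := F2 x0; lra.
have DI : [set` I] `&` `[x, +oo[ `<=` (`[x, +oo[%classic : set (@lebR R)) by move=> t [].
apply: integral_ge_itv.
- by apply: measurableI; exact: measurable_lebR_itv.
- exact: measurable_div_id x0 DI (mL n).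
- move=> t [_ /=]; rewrite in_itv/= andbT => xt.
  by rewrite divr_ge0 ?localize_ge0// (le_trans (ltW x0)).
- lra.
- by rewrite divr_ge0// ltW.
- move=> t xt; have tE := ends_double xE xt; move/andP: xt => [xt tx].
  have t0 : 0 < t by exact: lt_trans xt.
  split; first by split; [case/endsP: tE|rewrite /= in_itv/= andbT ltW].
  rewrite /localize indicE mem_set// mulr1.
  apply: ler_pM => //; [by rewrite invr_ge0 ltW|exact: Fni|].
  by rewrite lef_pV2 ?posrE.
Qed.

End LowerBound.
End Ends.

(** * Order continuity *)

Section FromEndsToOrderContinuity.
Context {R : realType} (I : interval R) (X : banachFunctionSpace I).
Hypothesis HI : I = `[0, 1]%R \/ I = `[0, +oo[%R.
Hypothesis symX : symmetric_space X.
Local Notation mu := (leb_on I).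

Lemma localized_distribution_small (u : @lebR R -> R) (A : nat -> set (@lebR R)) (s a : R) :
  measurable_fun setT u -> finite_distribution I u -> (forall n, measurable (A n)) ->
  (forall n, A n.+1 `<=` A n) -> \bigcap_n A n = set0 -> 0 < s -> 0 < a ->
  exists K, forall k, (K <= k)%N -> (distribution I (localize u (A k)) s <= a%:E)%E.
Proof.
move=> mu_ fu mA AS A0 s0 a0.
have mL k : measurable_fun setT (localize u (A k)) by exact: measurable_localize.
pose F k : set (@lebR R) := [set t | s < `|localize u (A k) t|].
have FE k t : F k t <-> A k t /\ s < `|u t|.
  rewrite /F /localize /= indicE; case: (pselect (A k t)) => [At|nA].
    by rewrite mem_set// mulr1; split => // -[].
  by rewrite memNset// mulr0 normr0; split => [|[]//]; rewrite ltNge ltW.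
have mF k : measurable (F k) by exact: measurable_gt.
have F0 : \bigcap_n F n = set0.
  rewrite -subset0 => t Ft; suff : (\bigcap_n A n) t by rewrite A0.
  by move=> n _; have /FE[] := Ft n Logic.I.
have Fle m n : (m <= n)%N -> F n `<=` F m.
  elim: n => [|n IH]; first by rewrite leqn0 => /eqP ->.
  rewrite leq_eqVlt => /orP[/eqP->//|] /IH ih t /FE[/AS At su]; apply: ih.
  by apply/FE.
have Ffin : (mu (F 0%N) < +oo)%E.
  apply: le_lt_trans (fu s s0); apply: leb_on_ae_le; [exact: mF|exact: measurable_gt|].
  by apply: nearW => t /FE[].
have cF : (mu \o F) n @[n --> \oo] --> 0%E.
  rewrite -(measure0 mu) -F0; apply: nonincreasing_cvg_mu => //.
    by rewrite F0; exact: measurable0.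
  by move=> m n mn; apply/subsetPset; exact: Fle.
have [K FK] : exists K, (mu (F K) <= a%:E)%E.
  apply: contrapT => h; have : (a%:E <= lim ((mu \o F) n @[n --> \oo]))%E.
    apply: lime_ge; first by apply/cvg_ex; exists 0%E.
    by apply: nearW => n /=; rewrite leNgt; apply/negP => /ltW Fx; apply: h; exists n.
  by rewrite (cvg_lim _ cF)// lee_fin leNgt a0.
exists K => k Kk; apply: le_trans FK; apply: leb_on_ae_le; [exact: mF|exact: mF|].
by apply: nearW; exact: Fle.
Qed.

(** Away from the ends, the rearrangement of [f chi_(A k)] is eventually below
    [e F], since at [1 / n.+1] it falls below the constant [e * F n.+1]; on the
    ends it is below [F]. *)
Lemma order_continuous_of_ends (f : X) (F : @lebR R -> R) (yF : X) :
  let u := L0_fun (bfs_incl X f) in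
  finite_distribution I u ->
  measurable_fun setT F -> represents yF F -> (forall t, 0 <= F t) ->
  (forall x, 0 < x -> 0 < F x) ->
  (forall x y, 0 < x -> x <= y -> F y <= F x) ->
  (forall x, 0 < x -> rearrangement I u x <= F x) ->
  (forall e, 0 < e -> exists n (x : X),
     represents x (localize F (ends I n)) /\ `|x| <= e) ->
  forall (A : nat -> set (@lebR R)) (h : nat -> X),
    (forall n, measurable (A n)) -> (forall n, A n.+1 `<=` A n) ->
    \bigcap_n A n = set0 ->
    (forall n, {ae mu, forall t,
       L0_fun (bfs_incl X (h n)) t = u t * \1_(A n) t}) ->
    (fun n => `|h n|) @ \oo --> (0 : R).
Proof.
move=> u fu mF FyF F0 Fpos Fni uF small A h mA AS A0 hE.
have mu_ : measurable_fun setT u by exact: measurable_L0_fun.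
apply/cvgr0Pnorm_lt => d d0.
pose e := d / (2 + `|yF|).
have y2 : 0 < 2 + `|yF| by rewrite ltr_wpDr.
have e0 : 0 < e by rewrite divr_gt0.
have [n [x [xE xe]]] := small _ e0.
have n0 : 0 < n.+1%:R :> R by rewrite ltr0n.
have a0 : 0 < n.+1%:R^-1 :> R by rewrite invr_gt0.
have s0 : 0 < e * F n.+1%:R by rewrite mulr_gt0// Fpos.
have [K HK] := localized_distribution_small mu_ fu mA AS A0 s0 a0.
exists K => // k /= /HK dk; rewrite normr_id.
pose g := localize u (A k).
have mg : measurable_fun setT g by exact: measurable_localize.
have fg : finite_distribution I g.
  move=> s sp; apply: le_lt_trans (fu s sp); apply: distribution_le => //.
  by apply: nearW => t; rewrite normrM ler_piMr// indicE; case: (_ \in _); rewrite ?normr1 ?normr0.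
have gu t : 0 < t -> rearrangement I g t <= rearrangement I u t.
  apply: rearrangement_le => //.
  by apply: nearW => r; rewrite normrM ler_piMr// indicE; case: (_ \in _); rewrite ?normr1 ?normr0.
have mr : measurable_fun setT (rearrangement I g) by exact: measurable_rearrangement.
have [z zE zh] := represents_symmetric symX mr mg (hE k)
  (fun s => @rearrangement_equimeasurable _ _ HI g s mg fg).
have key : {ae mu, forall t, `|rearrangement I g t| <= `|e * F t + localize F (ends I n) t|}.
  apply: filterS (ae_pos HI) => t [It t0].
  rewrite (ger0_norm (rearrangement_ge0 mg fg t)) ger0_norm; last first.
    by rewrite addr_ge0 ?localize_ge0// mulr_ge0// ltW.
  rewrite /localize indicE; case: (pselect (ends I n t)) => [tE|nE].
    rewrite mem_set// mulr1; apply: le_trans (gu t t0) _; apply: le_trans (uF t t0) _.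
    by rewrite lerDr mulr_ge0// ltW.
  rewrite memNset// mulr0 addr0.
  have [nt tn] : n.+1%:R^-1 <= (t : R) /\ (t : R) <= n.+1%:R.
    split; rewrite leNgt; apply/negP => h'; apply: nE; apply/endsP; split => //.
      by left; rewrite t0.
    by right.
  apply: (@le_trans _ _ (e * F n.+1%:R)); last by rewrite ler_pM2l// Fni.
  rewrite leNgt; apply/negP; rewrite (rearrangement_gt mg fg t0 (ltW s0)) => td.
  by have := lt_le_trans td dk; rewrite lte_fin ltNge nt.
have := represents_le zE (represents_linear e FyF xE) key.
rewrite zh => /le_lt_trans; apply; apply: le_lt_trans (ler_normD _ _) _.
rewrite normrZ (gtr0_norm e0).
have -> : d = e * (2 + `|yF|) by rewrite /e; field; rewrite gt_eqF.
rewrite mulrDr; lra.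
Qed.

End FromEndsToOrderContinuity.

Theorem corollary7p4 (R : realType) (I : interval R)
    (T : (@lebR R -> R) -> @lebR R -> \bar R) (X : banachFunctionSpace I) :
  I = `[0, 1]%R \/ I = `[0, +oo[%R ->
  T = cesaro_op \/ T = copson_op I ->
  symmetric_space X ->
  bounded_on cesaro_op X ->
  bounded_on (copson_op I) X ->
  ~ order_continuous X ->
  forall E : TX_renorming T X, ~ fixed_point_property E.
Proof.
move=> HI HT symX cesX copX noc E fpp; apply: noc => f A mA AI AS A0 h hE.
have Tpos : positive_integral_operator I T.
  by case: HT => ->; [exact: cesaro_positive|exact: copson_positive].
have Tbnd : bounded_on T X by case: HT => ->.
pose u := L0_fun (bfs_incl X f).
have mu_ : measurable_fun setT u by exact: measurable_L0_fun.
have fu : represents f u by exact: nearW.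
have [u0|un0] := pselect {ae leb_on I, forall t, u t = 0}.
  have h0 n : h n = 0.
    apply: (represents_inj (u := fun=> 0)) (represents0 X).
    by apply: filterS2 (hE n) u0 => t -> u0; rewrite -/(u t) u0 mul0r.
  by under eq_fun do rewrite h0 normr0; exact: cvg_cst.
have [F [yF [[mF FyF] [F0 Fpos] Fni F2 uF]]] :=
  exists_doubling_majorant HI symX cesX copX mu_ fu un0.
have [tau tauE] := exists_localized_image HI Tpos Tbnd mF F0 FyF.
have tau0 : (fun n => `|tau (ends I n)|) @ \oo --> (0 : R).
  apply: contrapT => ntau.
  have [e [B [e0 mB Bd Be]]] := disjoint_not_small HI Tpos mF F0 tauE
    (measurable_ends I) (@ends_decreasing _ I) (bigcap_ends I) ntau.
  have [J [al [be HJ]]] := optimal_domain_linfty_copy HI Tpos Tbnd mF F0 FyF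
    mB Bd tauE E e0 Be.
  exact: linfty_copy_not_fpp HJ fpp.
apply: (order_continuous_of_ends HI symX _ mF FyF F0 Fpos Fni uF _ mA AS A0 hE).
  exact: (element_finite_distribution HI symX copX mu_ fu).
move=> e e0; have e4 : 0 < e / 4 by lra.
have [n _ /(_ n (leqnn n)) /= ne] := cvgr0_norm_lt _ tau0 _ e4.
have mL : measurable_fun setT (localize F (ends I n.*2.+1)).
  by apply: measurable_localize => //; exact: measurable_ends.
exists n.*2.+1.
have [x xE xt] : exists2 x : X, represents x (localize F (ends I n.*2.+1)) &
    `|x| <= `|4 *: tau (ends I n) + 0|.
  pose W := L0_fun (bfs_incl X (tau (ends I n))).
  have WE : represents (tau (ends I n)) W by exact: nearW.
  apply: (represents_ideal mL (represents_linear 4 WE (represents0 X))).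
  apply: filterS2 (ae_pos HI) (tauE _ (measurable_ends I n)) => t [It t0] Wt.
  rewrite addr0 (ger0_norm (localize_ge0 F0 _ _)); apply: le_trans (ler_norm _).
  rewrite /localize indicE; case: (pselect (ends I n.*2.+1 t)) => [tE|nE].
    rewrite mem_set// mulr1 -ler_pdivrMl// mulrC -lee_fin -/(W t) Wt.
    by case: HT => ->; [exact: cesaro_ends_ge|exact: copson_ends_ge].
  rewrite memNset// mulr0 mulr_ge0// -lee_fin Wt.
  exact: (operator_ge0 Tpos It t0 (localize_ge0 F0 _)).
exists x; split => //; apply: le_trans xt _.
rewrite addr0 normrZ ger0_norm//; move: ne; rewrite normr_id; lra.
Qed.
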